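(* Let $a\in[\pi/3,2\pi/5)$, let $h\in L_2(5a/2,\pi)$ be a nonzero real-valued function, let $\eta$ be a nonzero eigenvalue of the operator $M_h$, put $h_1(x):=-h(x)/\eta$, and let $e_1$ be an eigenfunction of $M_{h_1}$ related to the eigenvalue $-1$, i.e. $M_{h_1}e_1(x)=-e_1(x)$ for $\frac{3a}{2}<x<\pi-a$. For $\alpha\in\mathbb{C}$ let $q_{\alpha,1}$ be the potential constructed from $h_1$, $e_1$ and $\alpha$ as described in the context. If $$\int_{3a/2}^{\pi-a} e_1(x)\,dx=0,$$ then for each $j\in\{0,1\}$ the spectrum of the boundary value problem $\mathcal{L}_{1,j}(a,q_{\alpha,1})$ is independent of $\alpha\in\mathbb{C}$.
   Context: For $\nu,j\in\{0,1\}$, $a\in(0,\pi)$ and a complex-valued $q\in L_2(0,\pi)$ with $q(x)=0$ on $(0,a)$, $\mathcal{L}_{\nu,j}(a,q)$ denotes the eigenvalue problem $$-y''(x)+q(x)y(x-a)=\lambda y(x),\quad 0<x<\pi,\qquad y^{(\nu)}(0)=y^{(j)}(\pi)=0.$$ (Since $q=0$ on $(0,a)$, the values of $y$ at negative arguments play no role.) Let $y_0(x,\lambda),y_1(x,\lambda)$ be the unique solutions of the equation with $y_\nu^{(j)}(0,\lambda)=\delta_{\nu,j}$ (Kronecker delta). The spectrum of $\mathcal{L}_{\nu,j}(a,q)$, with account of multiplicity, is the collection of zeros of the entire characteristic function $\Delta_{\nu,j}(\lambda)=y_{1-\nu}^{(j)}(\pi,\lambda)$. For $a\in[\pi/3,2\pi/5)$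 and $h\in L_2(5a/2,\pi)$ define $$K_h(x)=\int_x^\pi h(\tau)\,d\tau,\qquad M_hf(x)=\int_{3a/2}^{\pi-x+a/2}K_h\Big(x+t-\frac a2\Big)f(t)\,dt,\quad \frac{3a}2<x<\pi-a,$$ an integral operator in $L_2(3a/2,\pi-a)$. For nonzero real-valued $h$, $M_h$ is a nonzero compact Hermitian operator, so it has a nonzero eigenvalue. Given $h_1$ and $e_1$, for $\alpha\in\mathbb{C}$ the potential $q_{\alpha,1}$ on $(0,\pi)$ is $$q_{\alpha,1}(x)=\begin{cases}0, & x\in(0,\frac{3a}2)\cup(\pi-a,2a)\cup(\pi-\frac a2,\frac{5a}2),\\ \alpha e_1(x), & x\in(\frac{3a}2,\pi-a),\\ -\alpha K_{h_1}(x+\frac a2)\displaystyle\int_{3a/2}^{x-a/2}e_1(t)\,dt, & x\in(2a,\pi-\frac a2),\\ h_1(x), & x\in(\frac{5a}2,\pi).\end{cases}$$ (For $a=\pi/3$ the intervals $(\pi-a,2a)$ and $(\pi-a/2,5a/2)$ are empty.) *)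

(* Defs.v *)
From HB Require Import structures.
From mathcomp Require Import all_boot all_order all_algebra complex.
From mathcomp Require Import all_classical all_reals all_analysis.

Set Implicit Arguments.
Unset Strict Implicit.
Unset Printing Implicit Defensive.

Import Order.TTheory GRing.Theory Num.Theory.
Import numFieldNormedType.Exports.

Local Open Scope classical_set_scope.
Local Open Scope ring_scope.
Local Open Scope complex_scope.

Definition cRe (R : realType) (f : R -> R[i]) (x : R) : R := complex.Re (f x).
Definition cIm (R : realType) (f : R -> R[i]) (x : R) : R := complex.Im (f x).

Definition Cintegral (R : realType) (D : set R) (f : R -> R[i]) : R[i] :=
  (\int[lebesgue_measure]_(x in D) cRe f x)
    +i* (\int[lebesgue_measure]_(x in D) cIm f x).

Definition Cintegrable (R : realType) (D : set R) (f : R -> R[i]) : Prop :=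
  lebesgue_measure.-integrable D (EFin \o cRe f) /\
  lebesgue_measure.-integrable D (EFin \o cIm f).

(* Elements of L_2(D) are represented by functions on the whole line, of which
   only the values on D matter; equality in L_2(D) is equality a.e. on D. *)
Definition L2 (R : realType) (D : set R) (f : R -> R[i]) : Prop :=
  cRe f \_ D \in Lfun lebesgue_measure 2%:E /\
  cIm f \_ D \in Lfun lebesgue_measure 2%:E.

Definition ae_on (R : realType) (D : set R) (P : R -> Prop) : Prop :=
  {ae lebesgue_measure, forall x : R, D x -> P x}.

Definition L2_eigenfunction (R : realType) (D : set R)
    (T : (R -> R[i]) -> R -> R[i]) (eta : R[i]) (f : R -> R[i]) : Prop :=
  [/\ L2 D f,
      ~ ae_on D (fun x => f x = 0)
    & ae_on D (fun x => T f x = eta * f x)].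

Definition L2_eigenvalue (R : realType) (D : set R)
    (T : (R -> R[i]) -> R -> R[i]) (eta : R[i]) : Prop :=
  exists f, L2_eigenfunction D T eta f.

(* f is absolutely continuous on [0, pi] with derivative g (in L_1): absolute
   continuity is taken as "being the indefinite Lebesgue integral of an
   integrable function". When g is continuous, f is C^1 with f' = g. *)
Definition AC_with_derivative (R : realType) (f g : R -> R[i]) : Prop :=
  Cintegrable `[0, pi] g /\
  forall x : R, 0 <= x <= pi -> f x = f 0 + Cintegral `[0, x] g.

(* Indices in {0,1} are booleans (false = 0, true = 1). The function y is
   represented together with its derivative: u false = y, u true = y', so that
   u j = y^(j); the function w below is y''. *)
Definition solution (R : realType) (a : R) (q : R -> R[i]) (lambda : R[i])
    (u : bool -> R -> R[i]) : Prop :=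
  AC_with_derivative (u false) (u true) /\
  exists2 w, AC_with_derivative (u true) w &
    ae_on `]0, pi[
      (fun x => - w x + q x * u false (x - a) = lambda * u false x).

(* u j = y_nu^(j) for the solution with y_nu^(j)(0) = delta_{nu,j}. It is
   unique on [0, pi] when q is integrable and vanishes on (0, a); values outside
   [0, pi] are irrelevant. *)
Definition fundamental_solution (R : realType) (a : R) (q : R -> R[i])
    (nu : bool) (lambda : R[i]) : bool -> R -> R[i] :=
  xget (fun _ _ => 0)
    [set u | solution a q lambda u /\ forall j, u j 0 = (nu == j)%:R].

Definition Delta (R : realType) (nu j : bool) (a : R) (q : R -> R[i])
    (lambda : R[i]) : R[i] :=
  fundamental_solution a q (~~ nu) lambda j pi.

Definition zero_of_order (R : realType) (f : R[i] -> R[i]) (z : R[i]) (n : nat)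
    : Prop :=
  let D k := @derive1n R[i] R[i]^o k f z in
  (forall k, (k < n)%N -> D k = 0) /\ D n != 0.

(* The pairs (eigenvalue, multiplicity). *)
Definition spectrum (R : realType) (nu j : bool) (a : R) (q : R -> R[i])
    : set (R[i] * nat) :=
  [set p | (0 < p.2)%N /\ zero_of_order (Delta nu j a q) p.1 p.2].

Definition K (R : realType) (h : R -> R[i]) (x : R) : R[i] :=
  Cintegral `]x, pi[ h.

Definition M (R : realType) (a : R) (h f : R -> R[i]) (x : R) : R[i] :=
  Cintegral `]3 * a / 2, pi - x + a / 2[
    (fun t => K h (x + t - a / 2) * f t).

(* The nonzero pieces live on pairwise disjoint intervals for a in
   [pi/3, 2 pi/5); the value 0 is also taken at the finitely many endpoints. *)
Definition potential (R : realType) (a : R) (h1 e1 : R -> R[i]) (alpha : R[i])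
    (x : R) : R[i] :=
  if 3 * a / 2 < x < pi - a then alpha * e1 x
  else if 2 * a < x < pi - a / 2 then
    - alpha * K h1 (x + a / 2) * Cintegral `]3 * a / 2, x - a / 2[ e1
  else if 5 * a / 2 < x < pi then h1 x
  else 0.

(* Main.v *)
Require Import Defs.
From HB Require Import structures.
From mathcomp Require Import all_boot all_order all_algebra complex.
From mathcomp Require Import all_classical all_reals all_analysis.
From mathcomp Require Import measurable_realfun ring lra.

(** The characteristic functions themselves, not only their zeros, are
    independent of alpha.  Write q = alpha p + H, where H is h1 on
    (5a/2, pi) and p collects the pieces of the potential carrying the factor
    alpha, and let c, s be the solutions of y'' = - lambda y with the initial
    data of cosine and sine.  Since q vanishes on (0, 3a/2) and
    pi - a <= 2a, the delay makes the equation solvable in three explicit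
    steps: the solution y with y(0) = 1, y'(0) = 0 is c on [0, 3a/2], is
    c + alpha z on [0, pi - a] with z the response to e1(t) c(t - a) (the
    response to F solves y'' + lambda y = F with zero initial data), and on
    the whole interval is c plus the response to
    H(t) c(t - a) + alpha (p(t) c(t - a) + H(t) z(t - a)).
    This description gives existence ([solution_exists]), uniqueness and the
    value at pi ([solution_endpoint]); it is affine in alpha.

    The slope of y(pi), and of y'(pi), is the integral of
    phi(t) (p(t) c(t - a) + H(t) z(t - a)) with phi(t) = s(pi - t), and
    phi(t) = c(pi - t) respectively.  It vanishes ([source_orthogonal]) for
    every phi solving phi'' = - lambda phi, by the addition formula
    2 phi(x) c(y) = phi(x - y) + phi(x + y).
    With K the tail integral of H and E the running integral of e1:
    - the piece of p on (3a/2, pi - a) gives half the integral of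
      phi(2x - a) e1(x), because e1 has mean zero;
    - in the term with z, an integration by parts replaces H by K and
      phi(x) z(x - a) by its derivative, which is half the sum of
      phi(2x - 2a) E(x - a) and of the integral of phi(2(x - t)) e1(t) over
      t <= x - a;
    - the first of these two cancels the piece of p on (2a, pi - a/2) after a
      translation by a/2, up to a multiple of the integral of K(x) E(x - a);
    - the second is, by Fubini and a translation, the pairing of phi(2x - a)
      with M e1 ([adjoint_eigen]), so M e1 = - e1 makes it cancel the first
      piece of p; the same lemma with the constant function 1 for phi shows
      that the integral of K(x) E(x - a) is minus the mean of e1, hence zero.

    All integrals are taken over the whole line, with domains of integration
    written as indicator factors; this turns changes of variables into
    translations and all exchanges of integrals into one Fubini lemma
    ([cintegral_swap]).  Absolutely continuous functions are handled through
    the product rule [AC_M], itself an instance of that lemma. *)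

Set Implicit Arguments.
Unset Strict Implicit.
Unset Printing Implicit Defensive.

Import Order.TTheory GRing.Theory Num.Theory.
Import numFieldNormedType.Exports.

Local Open Scope classical_set_scope.
Local Open Scope ring_scope.
Local Open Scope complex_scope.

(** * Locally bounded kernels and compactly supported densities *)

Section RealKernels.
Variable R : realType.
Local Notation mu := (@lebesgue_measure R).
Implicit Types (f g : R -> R) (a b k : R -> R -> R).

(** Functions of one variable are treated as kernels constant in the other
    variable, so that a single family of closure properties covers both. *)
Definition rkernel k :=
  measurable_fun setT (fun z : R * R => k z.1 z.2) /\
  forall B, exists M, forall x y, `|x| <= B -> `|y| <= B -> `|k x y| <= M.

(** Bounded support is what lets kernels that are only locally bounded, such
    as exponentials, multiply an integrable function. *)
Definition rdensity g :=
  mu.-integrable setT (EFin \o g) /\ exists B, forall x, B < `|x| -> g x = 0.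

Lemma rkernel_cst c : rkernel (fun _ _ => c).
Proof. by split=> [|B]; [exact: measurable_cst|exists `|c|]. Qed.

Lemma rkernel_fst : rkernel (fun x _ => x).
Proof. by split=> [|B]; [exact: measurable_fst|exists B]. Qed.

Lemma rkernel_snd : rkernel (fun _ y => y).
Proof. by split=> [|B]; [exact: measurable_snd|exists B]. Qed.

Lemma rkernelD a b : rkernel a -> rkernel b -> rkernel (fun x y => a x y + b x y).
Proof.
move=> [ma la] [mb lb]; split=> [|B]; first exact: measurable_funD.
have [M HM] := la B; have [N HN] := lb B; exists (M + N) => x y xB yB.
by rewrite (le_trans (ler_normD _ _)) ?lerD ?HM ?HN.
Qed.

Lemma rkernelM a b : rkernel a -> rkernel b -> rkernel (fun x y => a x y * b x y).
Proof.
move=> [ma la] [mb lb]; split=> [|B]; first exact: measurable_funM.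
have [M HM] := la B; have [N HN] := lb B; exists (M * N) => x y xB yB.
by rewrite normrM ler_pM ?HM ?HN.
Qed.

Lemma rkernelN a : rkernel a -> rkernel (fun x y => - a x y).
Proof.
move=> [ma la]; split=> [|B].
  exact: measurable_funN ma.
by have [M HM] := la B; exists M => x y xB yB; rewrite normrN HM.
Qed.

Lemma rkernelB a b : rkernel a -> rkernel b -> rkernel (fun x y => a x y - b x y).
Proof. by move=> ra rb; apply: rkernelD => //; exact: rkernelN. Qed.

Lemma rkernel_comp k a b : rkernel k -> rkernel a -> rkernel b ->
  rkernel (fun x y => k (a x y) (b x y)).
Proof.
move=> [mk lk] [ma la] [mb lb]; split=> [|B].
  apply: (@measurableT_comp _ _ _ _ _ _ (fun z : R * R => k z.1 z.2) setT
    (fun z : R * R => (a z.1 z.2, b z.1 z.2))) => //.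
  exact/measurable_fun_pair.
have [M HM] := la B; have [N HN] := lb B.
have [L HL] := lk (Num.max M N); exists L => x y xB yB.
by apply: HL; rewrite le_max ?HM ?HN ?orbT.
Qed.

Lemma rkernel_le a b : rkernel a -> rkernel b ->
  rkernel (fun x y => (a x y <= b x y)%R%:R).
Proof.
move=> [ma la] [mb lb]; split=> [|B]; last first.
  by exists 1 => x y _ _; case: (a x y <= b x y); rewrite ?normr1 ?normr0.
have -> : (fun z : R * R => (a z.1 z.2 <= b z.1 z.2)%R%:R) =
  (\1_(setT `&` [set z : R * R | a z.1 z.2 <= b z.1 z.2])) :> (_ -> R).
  apply/funext => z; rewrite indicE setTI; congr ((nat_of_bool _)%:R).
  by apply/idP/idP => [h|]; [rewrite inE|rewrite inE].
apply: measurable_indic; exact: measurable_fun_le.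
Qed.

Lemma rkernel_lt a b : rkernel a -> rkernel b ->
  rkernel (fun x y => (a x y < b x y)%R%:R).
Proof.
move=> ra rb; have -> : (fun x y => (a x y < b x y)%R%:R) =
  (fun x y => 1 - (b x y <= a x y)%R%:R) :> (R -> R -> R).
  by apply/funext => x; apply/funext => y; rewrite ltNge; case: (_ <= _) => /=; ring.
by apply: rkernelB; [exact: rkernel_cst|exact: rkernel_le].
Qed.

Lemma rkernel_continuous (h : R -> R) : continuous h -> rkernel (fun x _ => h x).
Proof.
move=> ch; split=> [|B].
  exact: (measurableT_comp (continuous_measurable_fun ch) measurable_fst).
have [B0|B0] := ltP B 0.
  by exists 0 => x y xB; move: (normr_ge0 x); lra.
have cn : {within `[- B, B], continuous (fun x => `|h x|)}.
  apply: continuous_subspaceT => x.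
  by apply: (@continuous_comp _ _ _ h Num.norm); [exact: ch|exact: norm_continuous].
have BB : - B <= B by lra.
have [c _ Hc] := EVT_max BB cn.
exists `|h c| => x y xB _; apply: Hc.
by rewrite in_itv /= -ler_norml.
Qed.

Lemma rkernel_section k x0 : rkernel k -> rkernel (fun x _ => k x0 x).
Proof. by move=> rk; apply: rkernel_comp => //; [exact: rkernel_cst|exact: rkernel_fst]. Qed.

Lemma rkernel_measurable1 (h : R -> R) :
  rkernel (fun x _ => h x) -> measurable_fun setT h.
Proof.
move=> [mh _].
apply: (@measurableT_comp _ _ _ _ _ _ (fun z : R * R => h z.1) setT
   (fun x : R => (x, 0 : R))) => //.
Qed.

Lemma rdensityD f g : rdensity f -> rdensity g -> rdensity (fun x => f x + g x).
Proof.
move=> [intf [B fB]] [intg [C gC]]; split.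
  exact: (integrableD (measurableT) intf intg).
exists (Num.max B C) => x; rewrite gt_max => /andP[xB xC].
by rewrite fB // gC // addr0.
Qed.

Lemma rdensityM (h : R -> R) g : rkernel (fun x _ => h x) -> rdensity g ->
  rdensity (fun x => h x * g x).
Proof.
move=> rh [intg [B gB]]; split; last by exists B => x xB; rewrite gB ?mulr0.
have [_ lh] := rh; have [M HM] := lh B.
have mh := rkernel_measurable1 rh.
have mg : measurable_fun setT g.
  by apply/measurable_EFinP; exact: measurable_int intg.
have i2 : mu.-integrable setT (fun x => (M * g x)%:E).
  exact: (integrableZl measurableT M intg).
apply: le_integrable i2 => //.
  by apply/measurable_EFinP; exact: measurable_funM.
move=> x _ /=; rewrite lee_fin !normrM.
have [xB|xB] := ltP B `|x|; first by rewrite gB // normr0 !mulr0.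
apply: ler_wpM2r => //.
by apply: le_trans (ler_norm M); apply: (HM x 0) => //; rewrite normr0 (le_trans _ xB).
Qed.

(** Lebesgue measure and its image under a translation agree on half-open
    intervals, hence everywhere. *)
Lemma rdensity_shift g c : rdensity g -> rdensity (fun x => g (x + c)) /\
  \int[mu]_x g (x + c) = \int[mu]_x g x.
Proof.
move=> [intg [B gB]].
have mg : measurable_fun setT g.
  by apply/measurable_EFinP; exact: measurable_int intg.
pose phi (x : R) : measurableTypeR R := x + c.
have mphi : measurable_fun setT phi.
  by apply: measurable_funD => //; exact: measurable_cst.
have pe : forall A, measurable A -> mu A = pushforward mu phi A.
  apply: lebesgue_measure_unique => //= _ [[u v]] _ <-.
  rewrite /pushforward /=.
  have -> : phi @^-1` `]u, v] = `]u - c, v - c]%classic.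
    by apply/seteqP; split => x; rewrite /= !in_itv /= /phi; lra.
  rewrite !lebesgue_measure_itv /= !lte_fin ltrD2r.
  by case: ifP => // _; rewrite -EFinB; congr EFin; lra.
have intgc : mu.-integrable setT (EFin \o (fun x => g (x + c))).
  have mgc : measurable_fun setT (EFin \o (fun x => g (x + c))).
    apply/measurable_EFinP.
    by apply: (@measurableT_comp _ _ _ _ _ _ g setT phi).
  apply/integrableP; split => //.
  move/integrableP : intg => [_]; apply: le_lt_trans.
  rewrite [leRHS](_ : _ = \int[pushforward mu phi]_x `|(EFin \o g) x|)%E; last first.
    by apply: eq_measure_integral => A mA _; exact: pe.
  rewrite ge0_integral_pushforward //.
  by apply: measurableT_comp => //; exact/measurable_EFinP.
split.
  split=> //; exists (B + `|c|) => x xB; apply: gB.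
  have := ler_normB (x + c) c; rewrite addrK; lra.
rewrite /Rintegral; congr fine.
rewrite [RHS](_ : _ = \int[pushforward mu phi]_x (EFin \o g) x)%E; last first.
  by apply: eq_measure_integral => A mA _; exact: pe.
rewrite integral_pushforward //; exact/measurable_EFinP.
Qed.

Lemma rkernel_measurable2 k y0 : rkernel k -> measurable_fun setT (fun x => k y0 x).
Proof. by move=> rk; apply: rkernel_measurable1; exact: rkernel_section. Qed.

(** The integrand is not integrable in both variables, the first being
    unrestricted; measurability therefore comes from Tonelli's theorem for the
    positive and negative parts separately. *)
Lemma rkernel_integral k g : rkernel k -> rdensity g ->
  rkernel (fun x _ => \int[mu]_t (k x t * g t)).
Proof.
move=> rk rg; have [intg [B gB]] := rg.
have mg : measurable_fun setT g.
  by apply/measurable_EFinP; exact: measurable_int intg.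
have intkg x : mu.-integrable setT (EFin \o (fun t => k x t * g t)).
  exact: (rdensityM (rkernel_section x rk) rg).1.
split.
  suff : measurable_fun setT (fun x => \int[mu]_t (k x t * g t)).
    by move=> m; exact: (measurableT_comp m measurable_fst).
  pose F (z : R * R) := (k z.1 z.2 * g z.2)%:E.
  have mF : measurable_fun setT F.
    apply/measurable_EFinP; apply: measurable_funM; first exact: rk.1.
    exact: measurableT_comp.
  apply: (@measurableT_comp _ _ _ _ _ _ (@fine R) setT
    (fun x => \int[mu]_t (k x t * g t)%:E)%E); first exact: fine_measurable.
  have -> : (fun x => \int[mu]_t (k x t * g t)%:E)%E = (fun x =>
      \int[mu]_t (F^\+ (x, t)) - \int[mu]_t (F^\- (x, t)))%E.
    apply/funext => x; rewrite [LHS]integralE; congr (_ - _)%E.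
      by apply: eq_integral => t _; rewrite /F unlock.
    by apply: eq_integral => t _; rewrite /F unlock.
  apply: emeasurable_funB.
    apply: (@measurable_fun_fubini_tonelli_F _ _ _ _ _ mu F^\+%E) => //.
    exact: measurable_funepos.
  apply: (@measurable_fun_fubini_tonelli_F _ _ _ _ _ mu F^\-%E) => //.
  exact: measurable_funeneg.
move=> A; have [M HM] := rk.2 (Num.max A B).
exists (\int[mu]_t (`|M| * `|g t|)) => x y xA _.
apply: le_trans (le_normr_Rintegral _ (intkg x)) _ => //.
have ing : mu.-integrable setT (EFin \o (fun t => `|M| * `|g t|)).
  exact: (integrableZl measurableT `|M| (integrable_norm intg)).
apply: le_Rintegral => //; first exact: integrable_norm.
move=> t _; rewrite normrM.
have [tB|tB] := ltP B `|t|; first by rewrite gB // normr0 !mulr0.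
by apply: ler_wpM2r => //; apply: le_trans (ler_norm _); apply: HM;
  rewrite le_max ?xA ?tB ?orbT.
Qed.

Definition rintegrable2 (F : R -> R -> R) :=
  (mu \x mu)%E.-integrable setT (fun z : R * R => (F z.1 z.2)%:E).

Lemma rintegrable2D F G : rintegrable2 F -> rintegrable2 G ->
  rintegrable2 (fun x y => F x y + G x y).
Proof.
move=> iF iG; exact: (integrableD (measurableT) iF iG).
Qed.

Lemma rintegrable2N F : rintegrable2 F -> rintegrable2 (fun x y => - F x y).
Proof.
by move=> iF; exact: (integrableN iF).
Qed.

(** The supports of [f] and [g] confine the kernel to a square where it is
    bounded, so a multiple of |f(x)| |g(y)| dominates. *)
Lemma rintegrable2_kernel f g k : rdensity f -> rdensity g -> rkernel k ->
  rintegrable2 (fun x y => f x * (k x y * g y)).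
Proof.
move=> rf rg rk; have [intf [A fA]] := rf; have [intg [B gB]] := rg.
have mf : measurable_fun setT f.
  by apply/measurable_EFinP; exact: measurable_int intf.
have mg : measurable_fun setT g.
  by apply/measurable_EFinP; exact: measurable_int intg.
have [M HM] := rk.2 (Num.max A B).
apply/integrable12ltyP.
  apply/measurable_EFinP; apply: measurable_funM; first exact: measurableT_comp.
  by apply: measurable_funM; [exact: rk.1|exact: measurableT_comp].
have [ifn ign] := (integrable_norm intf, integrable_norm intg).
apply: (@le_lt_trans _ _
  (\int[mu]_x ((`|f x| * (`|M| * \int[mu]_y `|g y|))%:E))%E); last first.
  have := integrableZr measurableT (`|M| * \int[mu]_y `|g y|) ifn.
  by move/integrable_lty; apply.
apply: ge0_le_integral => //.
- by move=> x _; exact: integral_ge0.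
- pose F (z : R * R) := `|(f z.1 * (k z.1 z.2 * g z.2))%:E|%E.
  apply: (@measurable_fun_fubini_tonelli_F _ _ _ _ _ mu F) => //.
  apply: measurableT_comp => //.
  apply/measurable_EFinP; apply: measurable_funM; first exact: measurableT_comp.
  by apply: measurable_funM; [exact: rk.1|exact: measurableT_comp].
- by move=> z; exact: abse_ge0.
- apply/measurable_EFinP; apply: measurable_funM; last exact: measurable_cst.
  exact: measurableT_comp.
move=> x _ /=.
have i3 : mu.-integrable setT (EFin \o (fun y => `|f x| * (`|M| * `|g y|))).
  rewrite (_ : _ \o _ = EFin \o (fun y => (`|f x| * `|M|) * `|g y|)).
    exact: (integrableZl measurableT (`|f x| * `|M|) ign).
  by apply/funext => y /=; rewrite mulrA.
have -> : `|f x| * (`|M| * \int[mu]_y `|g y|) =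
   \int[mu]_y (`|f x| * (`|M| * `|g y|)).
  rewrite mulrA -RintegralZl //; apply: eq_Rintegral => y _; rewrite mulrA //.
rewrite /Rintegral fineK; last exact: (integrable_fin_num measurableT i3).
have [m1 _] := integrableP _ _ _ i3.
apply: ge0_le_integral => //.
- have mk : measurable_fun setT (fun y => f x * (k x y * g y)).
    apply: measurable_funM; first exact: measurable_cst.
    by apply: measurable_funM => //; exact: rkernel_measurable2.
  by apply/measurable_EFinP; exact: (measurableT_comp (@normr_measurable R setT) mk).
move=> y _; rewrite lee_fin !normrM.
have [xA|xA] := ltP A `|x|; first by rewrite fA // normr0 !mul0r.
have [yB|yB] := ltP B `|y|; first by rewrite gB // normr0 !mulr0.
apply: ler_wpM2l => //; apply: ler_wpM2r => //.
by apply: le_trans (ler_norm _); apply: HM; rewrite le_max ?xA ?yB ?orbT.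
Qed.

Lemma rintegrable2_swap F : rintegrable2 F ->
  (forall x, mu.-integrable setT (EFin \o F x)) ->
  (forall y, mu.-integrable setT (EFin \o F^~ y)) ->
  \int[mu]_x \int[mu]_y F x y = \int[mu]_y \int[mu]_x F x y.
Proof.
move=> iF i1 i2; rewrite /Rintegral; congr fine.
under eq_integral => x _ do rewrite fineK ?(integrable_fin_num measurableT (i1 x))//.
rewrite (Fubini iF).
by under [RHS]eq_integral => x _ do rewrite fineK ?(integrable_fin_num measurableT (i2 x))//.
Qed.

End RealKernels.

(** * Integrals of complex functions over the line *)

Fact iverson_key : unit. Proof. by []. Qed.
(** The Iverson bracket of a condition, as a scalar; sealed so that unification
    never compares the order relations inside it. *)
Definition iverson (R : realType) (b : bool) : R[i] := locked_with iverson_key b%:R.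
Local Notation "⟦ b ⟧" := (iverson _ b%R) (format "⟦ b ⟧").

Fact cintegral_key : unit. Proof. by []. Qed.

Section ComplexKernels.
Variable R : realType.
Local Notation mu := (@lebesgue_measure R).
Local Notation C := R[i].
Implicit Types (f g : R -> C) (k l : R -> R -> C) (z w : C) (a b : R -> R -> R).

Lemma cReD z w : complex.Re (z + w) = complex.Re z + complex.Re w.
Proof. by case: z; case: w. Qed.
Lemma cImD z w : complex.Im (z + w) = complex.Im z + complex.Im w.
Proof. by case: z; case: w. Qed.
Lemma cReM z w : complex.Re (z * w) =
  complex.Re z * complex.Re w - complex.Im z * complex.Im w.
Proof. by case: z; case: w. Qed.
Lemma cImM z w : complex.Im (z * w) =
  complex.Re z * complex.Im w + complex.Im z * complex.Re w.
Proof. by case: z; case: w. Qed.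
Lemma Re_iverson (b : bool) : complex.Re ⟦b⟧ = b%:R :> R.
Proof. by rewrite /iverson unlock; case: b. Qed.
Lemma Im_iverson (b : bool) : complex.Im ⟦b⟧ = 0 :> R.
Proof. by rewrite /iverson unlock; case: b. Qed.
Lemma iverson1 : ⟦true⟧ = 1 :> C. Proof. by rewrite /iverson unlock. Qed.
Lemma iverson0 : ⟦false⟧ = 0 :> C. Proof. by rewrite /iverson unlock. Qed.
Lemma iversonM (p q : bool) : ⟦p && q⟧ = ⟦p⟧ * ⟦q⟧ :> C.
Proof. by case: p; rewrite ?iverson1 ?iverson0 ?mul1r ?mul0r. Qed.

Definition ckernel k := rkernel (fun x y => complex.Re (k x y)) /\
  rkernel (fun x y => complex.Im (k x y)).

Definition cdensity f := rdensity (cRe f) /\ rdensity (cIm f).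

(** Sealed like [iverson], to keep rewriting from unfolding the two real
    integrals. *)
Definition cintegral f := locked_with cintegral_key (Cintegral setT) f.

Lemma Re_cintegral f : complex.Re (cintegral f) = \int[mu]_x complex.Re (f x).
Proof. by rewrite /cintegral unlock. Qed.
Lemma Im_cintegral f : complex.Im (cintegral f) = \int[mu]_x complex.Im (f x).
Proof. by rewrite /cintegral unlock. Qed.

Lemma ckernel_cst z : ckernel (fun _ _ => z).
Proof. by split; exact: rkernel_cst. Qed.

Lemma ckernelD k l : ckernel k -> ckernel l -> ckernel (fun x y => k x y + l x y).
Proof.
move=> [k1 k2] [l1 l2]; split.
  by under eq2_fun do rewrite cReD; exact: rkernelD.
by under eq2_fun do rewrite cImD; exact: rkernelD.
Qed.

Lemma ckernelM k l : ckernel k -> ckernel l -> ckernel (fun x y => k x y * l x y).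
Proof.
move=> [k1 k2] [l1 l2]; split.
  by under eq2_fun do rewrite cReM; apply: rkernelB; exact: rkernelM.
by under eq2_fun do rewrite cImM; apply: rkernelD; exact: rkernelM.
Qed.

Lemma ckernelN k : ckernel k -> ckernel (fun x y => - k x y).
Proof.
move=> hk; have := ckernelM (ckernel_cst (-1)) hk.
by under eq2_fun do rewrite mulN1r.
Qed.

Lemma ckernelB k l : ckernel k -> ckernel l -> ckernel (fun x y => k x y - l x y).
Proof. by move=> hk hl; apply: ckernelD => //; exact: ckernelN. Qed.

Lemma ckernel_comp k a b : ckernel k -> rkernel a -> rkernel b ->
  ckernel (fun x y => k (a x y) (b x y)).
Proof.
move=> [k1 k2] ha hb; split.
  exact: (rkernel_comp k1).
exact: (rkernel_comp k2).
Qed.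

Lemma ckernel_comp1 f a : ckernel (fun x _ => f x) -> rkernel a ->
  ckernel (fun x y => f (a x y)).
Proof. by move=> hf ha; exact: (ckernel_comp hf ha (rkernel_cst 0)). Qed.

Lemma ckernel_le a b : rkernel a -> rkernel b ->
  ckernel (fun x y => ⟦a x y <= b x y⟧).
Proof.
move=> ha hb; split.
  by under eq2_fun do rewrite Re_iverson; exact: rkernel_le.
by under eq2_fun do rewrite Im_iverson; exact: rkernel_cst.
Qed.

Lemma ckernel_lt a b : rkernel a -> rkernel b ->
  ckernel (fun x y => ⟦a x y < b x y⟧).
Proof.
move=> ha hb; split.
  by under eq2_fun do rewrite Re_iverson; exact: rkernel_lt.
by under eq2_fun do rewrite Im_iverson; exact: rkernel_cst.
Qed.

Lemma ckernel_and (p q : R -> R -> bool) : ckernel (fun x y => ⟦p x y⟧) ->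
  ckernel (fun x y => ⟦q x y⟧) -> ckernel (fun x y => ⟦p x y && q x y⟧).
Proof.
move=> hp hq; have := ckernelM hp hq.
congr ckernel; apply/funext => x; apply/funext => y.
by rewrite iversonM.
Qed.

Lemma ckernel_section k x0 : ckernel k -> ckernel (fun x _ => k x0 x).
Proof. by move=> [k1 k2]; split; [exact: (rkernel_section x0 k1)|exact: (rkernel_section x0 k2)]. Qed.

Lemma ckernel_section2 k y0 : ckernel k -> ckernel (fun x _ => k x y0).
Proof.
by move=> hk; apply: ckernel_comp => //; [exact: rkernel_fst|exact: rkernel_cst].
Qed.

Lemma cdensityD f g : cdensity f -> cdensity g -> cdensity (fun x => f x + g x).
Proof.
move=> [f1 f2] [g1 g2]; split; rewrite /cRe /cIm.
  by under eq_fun do rewrite cReD; exact: rdensityD.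
by under eq_fun do rewrite cImD; exact: rdensityD.
Qed.

Lemma rdensityB (f g : R -> R) : rdensity f -> rdensity g -> rdensity (fun x => f x - g x).
Proof.
move=> hf hg; apply: rdensityD => //.
have := rdensityM (rkernel_cst (-1)) hg.
by under eq_fun do rewrite mulN1r.
Qed.

Lemma cdensityM f g : ckernel (fun x _ => f x) -> cdensity g ->
  cdensity (fun x => f x * g x).
Proof.
move=> [f1 f2] [g1 g2]; split; rewrite /cRe /cIm.
  by under eq_fun do rewrite cReM; apply: rdensityB; exact: rdensityM.
by under eq_fun do rewrite cImM; apply: rdensityD; exact: rdensityM.
Qed.

Lemma cdensityZ z g : cdensity g -> cdensity (fun x => z * g x).
Proof. by apply: cdensityM; exact: ckernel_cst. Qed.

Lemma cdensityN g : cdensity g -> cdensity (fun x => - g x).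
Proof.
move=> hg; have := cdensityZ (-1) hg.
by under eq_fun do rewrite mulN1r.
Qed.

Lemma cdensityB f g : cdensity f -> cdensity g -> cdensity (fun x => f x - g x).
Proof. by move=> hf hg; apply: cdensityD => //; exact: cdensityN. Qed.

Lemma cdensity_Cintegrable f : cdensity f -> Cintegrable setT f.
Proof. by move=> [[? _] [? _]]. Qed.

Lemma complex_eq z w : complex.Re z = complex.Re w ->
  complex.Im z = complex.Im w -> z = w.
Proof. by case: z => a1 b1; case: w => a2 b2 /= -> ->. Qed.

Lemma cintegralD f g : cdensity f -> cdensity g ->
  cintegral (fun x => f x + g x) = cintegral f + cintegral g.
Proof.
move=> [[f1 _] [f2 _]] [[g1 _] [g2 _]]; apply: complex_eq; rewrite ?cReD ?cImD ?Re_cintegral ?Im_cintegral.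
  by rewrite -RintegralD //; apply: eq_Rintegral => x _; rewrite cReD.
by rewrite -RintegralD //; apply: eq_Rintegral => x _; rewrite cImD.
Qed.

Lemma cintegralZ z g : cdensity g -> cintegral (fun x => z * g x) = z * cintegral g.
Proof.
move=> [[g1 _] [g2 _]]; apply: complex_eq; rewrite ?cReM ?cImM !(Re_cintegral, Im_cintegral).
  rewrite -!RintegralZl // -RintegralB //.
  - by apply: eq_Rintegral => x _; rewrite /cRe cReM.
  - exact: (integrableZl measurableT (complex.Re z) g1).
  - exact: (integrableZl measurableT (complex.Im z) g2).
rewrite -!RintegralZl // -RintegralD //.
- by apply: eq_Rintegral => x _; rewrite /cIm cImM.
- exact: (integrableZl measurableT (complex.Re z) g2).
- exact: (integrableZl measurableT (complex.Im z) g1).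
Qed.

Lemma cintegralN g : cdensity g -> cintegral (fun x => - g x) = - cintegral g.
Proof.
move=> hg; rewrite -mulN1r -cintegralZ //; congr cintegral.
by apply/funext => x; rewrite mulN1r.
Qed.

Lemma cintegralB f g : cdensity f -> cdensity g ->
  cintegral (fun x => f x - g x) = cintegral f - cintegral g.
Proof. by move=> hf hg; rewrite cintegralD ?cintegralN //; exact: cdensityN. Qed.

Lemma cintegral0 : cintegral (fun _ => 0) = 0.
Proof.
by apply: complex_eq; rewrite !(Re_cintegral, Im_cintegral) /= Rintegral_cst // mul0r.
Qed.

Lemma eq_cintegral f g : f =1 g -> cintegral f = cintegral g.
Proof. by move=> /funext ->. Qed.

Lemma cdensity_shift g c : cdensity g -> cdensity (fun x => g (x + c)).
Proof.
move=> [g1 g2]; split.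
  exact: (rdensity_shift c g1).1.
exact: (rdensity_shift c g2).1.
Qed.

Lemma cintegral_shift g c : cdensity g -> cintegral (fun x => g (x + c)) = cintegral g.
Proof.
move=> [g1 g2]; apply: complex_eq; rewrite !(Re_cintegral, Im_cintegral).
  exact: (rdensity_shift c g1).2.
exact: (rdensity_shift c g2).2.
Qed.

Lemma ckernel_cintegral k g : ckernel k -> cdensity g ->
  ckernel (fun x _ => cintegral (fun t => k x t * g t)).
Proof.
move=> [k1 k2] [g1 g2]; split.
  under eq2_fun do rewrite Re_cintegral.
  have -> : (fun x (_ : R) => \int[mu]_t complex.Re (k x t * g t)) = (fun x _ =>
    \int[mu]_t (complex.Re (k x t) * cRe g t) - \int[mu]_t (complex.Im (k x t) * cIm g t)).
    apply/funext => x; apply/funext => _; rewrite -RintegralB //.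
    - by apply: eq_Rintegral => t _; rewrite cReM.
    - exact: (rdensityM (rkernel_section x k1) g1).1.
    - exact: (rdensityM (rkernel_section x k2) g2).1.
  by apply: rkernelB; exact: rkernel_integral.
under eq2_fun do rewrite Im_cintegral.
have -> : (fun x (_ : R) => \int[mu]_t complex.Im (k x t * g t)) = (fun x _ =>
  \int[mu]_t (complex.Re (k x t) * cIm g t) + \int[mu]_t (complex.Im (k x t) * cRe g t)).
  apply/funext => x; apply/funext => _; rewrite -RintegralD //.
  - by apply: eq_Rintegral => t _; rewrite cImM.
  - exact: (rdensityM (rkernel_section x k1) g2).1.
  - exact: (rdensityM (rkernel_section x k2) g1).1.
by apply: rkernelD; exact: rkernel_integral.
Qed.

(** Real and imaginary parts of the double integral are sums of four products
    of real densities and kernels, to which the real Fubini theorem applies. *)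
Lemma cintegral_swap f g k : cdensity f -> cdensity g -> ckernel k ->
  cintegral (fun x => f x * cintegral (fun y => k x y * g y)) =
  cintegral (fun y => g y * cintegral (fun x => k x y * f x)).
Proof.
move=> hf hg hk; pose F x y := f x * (k x y * g y).
have h1 x : cdensity (fun y => k x y * g y).
  by apply: cdensityM => //; exact: ckernel_section.
have h2 y : cdensity (fun x => k x y * f x).
  by apply: cdensityM => //; exact: ckernel_section2.
have d1 x : cdensity (F x) by exact: cdensityZ.
have d2 y : cdensity (F^~ y).
  have := cdensityZ (g y) (h2 y); congr cdensity.
  by apply/funext => x; rewrite /F; ring.
rewrite (_ : cintegral _ = cintegral (fun x => cintegral (F x))); last first.
  by apply: eq_cintegral => x; rewrite -cintegralZ.
rewrite [RHS](_ : _ = cintegral (fun y => cintegral (F^~ y))); last first.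
  apply: eq_cintegral => y; rewrite -cintegralZ //.
  by apply: eq_cintegral => x; rewrite /F; ring.
have [f1 f2] := hf; have [g1 g2] := hg; have [k1 k2] := hk.
have [e1 e2] : rintegrable2 (fun x y => complex.Re (F x y)) /\
   rintegrable2 (fun x y => complex.Im (F x y)).
  split.
    rewrite (_ : (fun _ => _) = (fun x y =>
      (cRe f x * (complex.Re (k x y) * cRe g y) +
       - (cRe f x * (complex.Im (k x y) * cIm g y))) +
      (- (cIm f x * (complex.Re (k x y) * cIm g y)) +
       - (cIm f x * (complex.Im (k x y) * cRe g y))))).
      do 2 (apply: rintegrable2D; try apply: rintegrable2N);
      exact: rintegrable2_kernel.
    by apply/funext => x; apply/funext => y; rewrite /F !(cReM, cImM) /cRe /cIm; ring.
  rewrite (_ : (fun _ => _) = (fun x y =>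
    (cRe f x * (complex.Re (k x y) * cIm g y) +
     (cRe f x * (complex.Im (k x y) * cRe g y))) +
    ((cIm f x * (complex.Re (k x y) * cRe g y)) +
     - (cIm f x * (complex.Im (k x y) * cIm g y))))).
    do 2 (apply: rintegrable2D; try apply: rintegrable2N);
    exact: rintegrable2_kernel.
  by apply/funext => x; apply/funext => y; rewrite /F !(cReM, cImM) /cRe /cIm; ring.
apply: complex_eq; rewrite !(Re_cintegral, Im_cintegral).
  under eq_Rintegral do rewrite Re_cintegral.
  under [RHS]eq_Rintegral do rewrite Re_cintegral.
  apply: (rintegrable2_swap e1) => x.
    exact: (d1 x).1.1.
  exact: (d2 x).1.1.
under eq_Rintegral do rewrite Im_cintegral.
under [RHS]eq_Rintegral do rewrite Im_cintegral.
apply: (rintegrable2_swap e2) => x.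
  exact: (d1 x).2.1.
exact: (d2 x).2.1.
Qed.

Lemma ae_eq_cintegral f g : cdensity f -> cdensity g ->
  {ae mu, forall x, f x = g x} -> cintegral f = cintegral g.
Proof.
move=> [[f1 _] [f2 _]] [[g1 _] [g2 _]] fg; apply: complex_eq;
  rewrite !(Re_cintegral, Im_cintegral) /Rintegral; congr fine.
  apply: ae_eq_integral => //; first exact: measurable_int f1.
    exact: measurable_int g1.
  by apply: negligibleS fg => x /= nfg fgx; apply: nfg => _; rewrite fgx.
apply: ae_eq_integral => //; first exact: measurable_int f2.
  exact: measurable_int g2.
by apply: negligibleS fg => x /= nfg fgx; apply: nfg => _; rewrite fgx.
Qed.

Lemma Cintegral_indic (D : set R) f : Cintegral D f = cintegral (fun x => ⟦x \in D⟧ * f x).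
Proof.
apply: complex_eq; rewrite (Re_cintegral, Im_cintegral) /= Rintegral_mkcond;
  apply: eq_Rintegral => x _;
  rewrite /cRe /cIm ?cReM ?cImM Re_iverson Im_iverson patchE; case: (x \in D);
  rewrite !(mul1r, mul0r, subr0, addr0) //=.
Qed.

Lemma Cintegrable_indic (D : set R) f : measurable D ->
  Cintegrable D f <-> Cintegrable setT (fun x => ⟦x \in D⟧ * f x).
Proof.
move=> mD; have eR : cRe (fun x => ⟦x \in D⟧ * f x) = (cRe f) \_ D.
  apply/funext => x; rewrite /cRe cReM Re_iverson Im_iverson patchE; case: (x \in D);
  rewrite !(mul1r, mul0r, subr0, addr0) //=.
have eI : cIm (fun x => ⟦x \in D⟧ * f x) = (cIm f) \_ D.
  apply/funext => x; rewrite /cIm cImM Re_iverson Im_iverson patchE; case: (x \in D);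
  rewrite !(mul1r, mul0r, subr0, addr0) //=.
rewrite /Cintegrable eR eI; split=> [] [h1 h2]; split.
- by have := (@integrable_mkcond _ _ R mu D (EFin \o cRe f) mD).1 h1; rewrite restrict_EFin.
- by have := (@integrable_mkcond _ _ R mu D (EFin \o cIm f) mD).1 h2; rewrite restrict_EFin.
- by apply/(@integrable_mkcond _ _ R mu D (EFin \o cRe f) mD).2; rewrite restrict_EFin.
- by apply/(@integrable_mkcond _ _ R mu D (EFin \o cIm f) mD).2; rewrite restrict_EFin.
Qed.

End ComplexKernels.

(** * Absolutely continuous functions and integration by parts *)

Section Primitives.
Variable R : realType.
Local Notation mu := (@lebesgue_measure R).
Local Notation C := R[i].
Implicit Types (f g phi gam : R -> C) (x t c : R).

Lemma ckernel_itv (a b : R -> R -> R) (u : R -> R -> R) :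
  rkernel a -> rkernel b -> rkernel u ->
  ckernel (fun x y => ⟦a x y <= u x y <= b x y⟧ : C).
Proof. by move=> ra rb ru; apply: ckernel_and; exact: ckernel_le. Qed.

Lemma negligible_set1 c : mu.-negligible [set c].
Proof. by exists [set c]; split=> //; exact: lebesgue_measure_set1. Qed.

Lemma eq_cintegral_off c f g : cdensity f -> cdensity g ->
  (forall x, x != c -> f x = g x) -> cintegral f = cintegral g.
Proof.
move=> hf hg fg; apply: ae_eq_cintegral => //.
apply: negligibleS (negligible_set1 c) => x /= nfg.
by apply: contrapT => xc; apply: nfg; apply: fg; exact/eqP.
Qed.

Definition prim g x := cintegral (fun t => ⟦0 <= t <= x⟧ * g t).

(** Derivatives are only controlled on [[0, pi]]; cutting them off there gives
    densities on the line. *)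
Definition onpi g t := ⟦0 <= t <= pi⟧ * g t.

Lemma onpi_in g t : 0 <= t <= pi -> onpi g t = g t.
Proof. by rewrite /onpi => ->; rewrite iverson1 mul1r. Qed.

Lemma cdensity_itv (a b : R) g : cdensity g ->
  cdensity (fun t => ⟦a <= t <= b⟧ * g t).
Proof.
move=> hg; apply: cdensityM => //; apply: ckernel_itv; try exact: rkernel_cst.
exact: rkernel_fst.
Qed.

Lemma ckernel_prim g : cdensity g -> ckernel (fun x _ => prim g x).
Proof.
move=> hg; apply: (@ckernel_cintegral _ (fun x t => ⟦0 <= t <= x⟧)) => //.
by apply: ckernel_itv; [exact: rkernel_cst|exact: rkernel_fst|exact: rkernel_snd].
Qed.

Lemma prim0 g : cdensity g -> prim g 0 = 0.
Proof.
move=> hg; rewrite /prim -(cintegral0 R); apply: (@eq_cintegral_off 0).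
- exact: cdensity_itv.
- have := cdensityZ 0 hg; by under eq_fun do rewrite mul0r.
move=> x x0; by rewrite -eq_le eq_sym (negbTE x0) iverson0 mul0r.
Qed.

Lemma eq_prim f g x : (forall t, 0 <= t <= x -> f t = g t) -> prim f x = prim g x.
Proof.
move=> fg; apply: eq_cintegral => t; have [tx|] := boolP (0 <= t <= x); last by rewrite iverson0 !mul0r.
by rewrite fg.
Qed.

Lemma primD f g x : cdensity f -> cdensity g ->
  prim (fun t => f t + g t) x = prim f x + prim g x.
Proof.
move=> hf hg; rewrite /prim -cintegralD; try exact: cdensity_itv.
by apply: eq_cintegral => t; rewrite mulrDr.
Qed.

Lemma primZ z f x : cdensity f -> prim (fun t => z * f t) x = z * prim f x.
Proof.
move=> hf; rewrite /prim -cintegralZ; last exact: cdensity_itv.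
by apply: eq_cintegral => t; rewrite mulrCA.
Qed.

(** The square [[0, x]]^2 splits along its diagonal into two triangles, and
    Fubini exchanges the order of integration on one of them. *)
Lemma primM f g x : cdensity f -> cdensity g ->
  prim f x * prim g x =
  prim (fun t => f t * prim g t + prim f t * g t) x.
Proof.
move=> hf hg.
pose k s t : C := ⟦0 <= t <= s⟧.
have hk : ckernel k.
  by apply: ckernel_itv; [exact: rkernel_cst|exact: rkernel_fst|exact: rkernel_snd].
have hfx : cdensity (fun t => k x t * f t) by exact: cdensity_itv.
have hgx : cdensity (fun t => k x t * g t) by exact: cdensity_itv.
have d1 : cdensity (fun t => f t * prim g t).
  by under eq_fun do rewrite mulrC; apply: cdensityM => //; exact: ckernel_prim.
have d2 : cdensity (fun t => prim f t * g t).
  by apply: cdensityM => //; exact: ckernel_prim.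
rewrite primD // addrC.
have -> : prim (fun t => prim f t * g t) x =
    cintegral (fun t => f t * cintegral (fun s => k s t * (k x s * g s))).
  rewrite -(@cintegral_swap _ (fun s => k x s * g s) f k) //.
  by apply: eq_cintegral => s; rewrite /prim /k; ring.
have hks t : cdensity (fun s => k s t * (k x s * g s)).
  by apply: cdensityM => //; exact: ckernel_section2.
rewrite /prim -/k -cintegralD.
- rewrite mulrC -cintegralZ //; apply: eq_cintegral => t.
  have [tx|tx] := boolP (0 <= t <= x); last first.
    rewrite !iverson0 !mul0r mulr0 addr0 (_ : (fun s => _) = (fun=> 0)) ?cintegral0 ?mulr0 //.
    apply/funext => s; rewrite /k mulrA -iversonM.
    rewrite (_ : _ && _ = false) ?iverson0 ?mul0r //.
    by apply: contraNF tx; lra.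
  rewrite !iverson1 !mul1r -mulrDr -cintegralD; [|exact: hks|exact: cdensity_itv].
  rewrite mulrC; congr (_ * _).
  apply: (@eq_cintegral_off t) => //; first exact: cdensityD (hks t) (cdensity_itv _ _ hg).
  move=> s st; rewrite /k mulrA -mulrDl -iversonM; congr (_ * _).
have [ts|ts] := boolP (t < s).
    rewrite (_ : 0 <= s <= t = false) ?iverson0 ?addr0; last by apply/negbTE; lra.
    by congr (⟦_⟧); apply/idP/idP; lra.
  have {}ts : s < t by rewrite lt_neqAle st leNgt.
  rewrite (_ : 0 <= t <= s = false) ?iverson0 ?add0r; last by apply/negbTE; lra.
  by congr (⟦_⟧); apply/idP/idP; lra.
- under eq_fun do rewrite mulrC; apply: cdensityM => //.
  apply: (@ckernel_cintegral _ (fun t s => k s t)); last exact: hgx.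
  by apply: ckernel_comp => //; [exact: rkernel_snd|exact: rkernel_fst].
- exact: cdensity_itv.
Qed.

Lemma Cintegral_prim g x : x <= pi -> Cintegral `[0, x] g = prim (onpi g) x.
Proof.
move=> xpi; rewrite Cintegral_indic; apply: eq_cintegral => t.
rewrite mem_setE in_itv /= /onpi.
have [/andP[t0 tx]|] := boolP (0 <= t <= x); last by rewrite iverson0 !mul0r.
by rewrite t0 (le_trans tx xpi) iverson1 !mul1r.
Qed.

Lemma cdensity_onpiP g : Cintegrable `[0, pi] g <-> cdensity (onpi g).
Proof.
rewrite Cintegrable_indic //.
have -> : (fun x => ⟦x \in `[0 : R, pi]%classic⟧ * g x) = onpi g.
  by apply/funext => x; rewrite mem_setE in_itv.
split=> [[h1 h2]|]; last exact: cdensity_Cintegrable.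
have bd x : pi < `|x| -> onpi g x = 0.
  rewrite /onpi => xpi; have [/andP[x0 xp]|] := boolP (0 <= x <= pi); last by rewrite iverson0 mul0r.
  by move: xpi; rewrite ger0_norm // ltNge xp.
by split; split => //; exists pi => x xpi; rewrite /cRe /cIm bd.
Qed.

Lemma AC_onpiP f g : AC_with_derivative f g <-> cdensity (onpi g) /\
  forall x, 0 <= x <= pi -> f x = f 0 + prim (onpi g) x.
Proof.
rewrite /AC_with_derivative cdensity_onpiP; split=> -[h1 h2].
  split; [exact: h1|move=> x xp; rewrite h2 //].
  by rewrite Cintegral_prim //; case/andP: xp.
split; [exact: h1|move=> x xp; rewrite h2 //].
by rewrite Cintegral_prim //; case/andP: xp.
Qed.

Lemma cdensity_onpi g : cdensity g -> cdensity (onpi g).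
Proof. exact: cdensity_itv. Qed.

Lemma ckernel_onpi f : ckernel (fun x _ => f x) -> ckernel (fun x _ => onpi f x).
Proof.
move=> hf; apply: ckernelM => //.
by apply: ckernel_itv; [exact: rkernel_cst|exact: rkernel_cst|exact: rkernel_fst].
Qed.

Lemma AC_ckernel f g : AC_with_derivative f g -> ckernel (fun x _ => onpi f x).
Proof.
move=> /AC_onpiP[hg fE].
have -> : (fun x _ => onpi f x) = (fun (x _ : R) => onpi (fun y => f 0 + prim (onpi g) y) x).
  apply/funext => x; apply/funext => _; rewrite /onpi.
  by have [xp|] := boolP (0 <= x <= pi); [rewrite fE|rewrite iverson0 !mul0r].
apply: ckernel_onpi; apply: ckernelD; [exact: ckernel_cst|exact: ckernel_prim].
Qed.

Lemma AC_prim g : cdensity g -> AC_with_derivative (prim g) g.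
Proof.
move=> hg; apply/AC_onpiP; split=> [|x /andP[x0 xp]]; first exact: cdensity_onpi.
rewrite prim0 // add0r; apply: eq_prim => t /andP[t0 tx].
by rewrite onpi_in // t0 (le_trans tx xp).
Qed.

Lemma AC_eq f f' g g' : AC_with_derivative f g ->
  (forall x, 0 <= x <= pi -> f x = f' x) ->
  (forall x, 0 <= x <= pi -> g x = g' x) -> AC_with_derivative f' g'.
Proof.
move=> /AC_onpiP[hg fE] ff' gg'; apply/AC_onpiP.
have cgg : onpi g = onpi g'.
  apply/funext => x; rewrite /onpi.
  by have [xp|] := boolP (0 <= x <= pi); [rewrite gg'|rewrite iverson0 !mul0r].
rewrite -cgg; split=> // x xp; rewrite -!ff' //; first exact: fE.
by rewrite lexx pi_ge0.
Qed.

(** The derivative matters only up to a null set; this is how an equation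
    holding almost everywhere enters. *)
Lemma AC_ae f g g' : AC_with_derivative f g -> cdensity (onpi g') ->
  ae_on `]0, pi[ (fun x => g x = g' x) -> AC_with_derivative f g'.
Proof.
move=> /AC_onpiP[hg fE] hg' gg'; apply/AC_onpiP; split=> // x xp.
rewrite fE //; congr (_ + _); apply: ae_eq_cintegral; try exact: cdensity_itv.
have : mu.-negligible (~` [set x | `]0, pi[%classic x -> g x = g' x] `|` [set 0; pi]).
  apply: negligibleU; first exact: gg'.
  by apply: negligibleU; exact: negligible_set1.
apply: negligibleS => t /= h; apply: contrapT => h'; apply: h.
congr (_ * _); rewrite /onpi; have [/andP[t0 tp]|] := boolP (0 <= t <= pi); last by rewrite iverson0 !mul0r.
congr (_ * _); apply: contrapT => h''; apply: h'; have [->|tn0] := eqVneq t 0.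
  by right; left.
have [->|tnp] := eqVneq t pi; first by right; right.
left => h3; apply: h''; apply: h3.
by rewrite in_itv /= !lt_neqAle tnp tp t0 eq_sym tn0.
Qed.

Lemma AC_cst z : AC_with_derivative (fun=> z) (fun=> 0 : C).
Proof.
have c0 : onpi (fun=> 0 : C) = (fun=> 0) by apply/funext => x; rewrite /onpi mulr0.
apply/AC_onpiP; rewrite c0; split=> [|x _].
  rewrite /cdensity /cRe /cIm /=.
  by split; split; (try exact: (integrable0 mu)); exists 0.
rewrite /prim; under eq_cintegral do rewrite mulr0.
by rewrite cintegral0 addr0.
Qed.

Lemma AC_D f f' g g' : AC_with_derivative f f' -> AC_with_derivative g g' ->
  AC_with_derivative (fun x => f x + g x) (fun x => f' x + g' x).
Proof.
move=> /AC_onpiP[hf fE] /AC_onpiP[hg gE]; apply/AC_onpiP.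
have cD : onpi (fun x => f' x + g' x) = (fun x => onpi f' x + onpi g' x).
  by apply/funext => x; rewrite /onpi mulrDr.
rewrite cD; split=> [|x xp]; first exact: cdensityD.
by rewrite primD // fE // gE //; ring.
Qed.

(** The product rule, obtained from [primM] after splitting off the initial
    values. *)
Lemma AC_M f f' g g' : AC_with_derivative f f' -> AC_with_derivative g g' ->
  AC_with_derivative (fun x => f x * g x) (fun x => f' x * g x + f x * g' x).
Proof.
move=> Af Ag; have kf := AC_ckernel Af; have kg := AC_ckernel Ag.
move: Af Ag => /AC_onpiP[hf fE] /AC_onpiP[hg gE]; apply/AC_onpiP.
have cE : onpi (fun x => f' x * g x + f x * g' x) =
    (fun x => onpi g x * onpi f' x + onpi f x * onpi g' x).
  apply/funext => x; rewrite /onpi; case: (0 <= x <= pi); rewrite ?iverson1 ?iverson0; ring.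
have d1 : cdensity (fun x => onpi g x * onpi f' x) by exact: cdensityM.
have d2 : cdensity (fun x => onpi f x * onpi g' x) by exact: cdensityM.
rewrite cE; split=> [|x xp]; first exact: cdensityD.
have dp1 : cdensity (fun t => onpi f' t * prim (onpi g') t).
  by under eq_fun do rewrite mulrC; apply: cdensityM => //; exact: ckernel_prim.
have dp2 : cdensity (fun t => prim (onpi f') t * onpi g' t).
  by apply: cdensityM => //; exact: ckernel_prim.
rewrite fE // gE //.
rewrite [in RHS](@eq_prim _ (fun t => (g 0 * onpi f' t + f 0 * onpi g' t) +
   (onpi f' t * prim (onpi g') t + prim (onpi f') t * onpi g' t))); last first.
  move=> t /andP[t0 tx].
  have tp : 0 <= t <= pi by rewrite t0 (le_trans tx) //; case/andP: xp.
  rewrite (onpi_in g) // (onpi_in f) // fE // gE //; ring.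
rewrite primD; [|by apply: cdensityD; exact: cdensityZ|exact: cdensityD].
rewrite -primM // primD ?primZ //; try exact: cdensityZ.
ring.
Qed.

Lemma AC_Z z f f' : AC_with_derivative f f' ->
  AC_with_derivative (fun x => z * f x) (fun x => z * f' x).
Proof.
move=> Af; apply: AC_eq (AC_M (AC_cst z) Af) _ _ => // x _; ring.
Qed.

Lemma AC_B f f' g g' : AC_with_derivative f f' -> AC_with_derivative g g' ->
  AC_with_derivative (fun x => f x - g x) (fun x => f' x - g' x).
Proof.
move=> Af Ag; apply: AC_eq (AC_D Af (AC_Z (-1) Ag)) _ _ => // x _; ring.
Qed.

End Primitives.

(** * The sine and cosine of the equation y'' = - lambda y *)

Section Trigonometry.
Variable R : realType.
Local Notation mu := (@lebesgue_measure R).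
Local Notation C := R[i].
Implicit Types (x y p q : R) (z lam : C).

Lemma Rintegral_derive (h h' : R -> R) x : 0 <= x ->
  (forall t, is_derive t (1 : R) h (h' t)) -> continuous h' ->
  \int[mu]_(t in `[0, x]) h' t = h x - h 0.
Proof.
rewrite le_eqVlt => /predU1P[<-|x0] dh ch'.
  by rewrite set_itv1 Rintegral_set1 subrr.
have ch : continuous h.
  move=> t; apply: differentiable_continuous; apply/derivable1_diffP.
  by have [] := dh t.
have d : derivable_oo_LRcontinuous h 0 x.
  split; first by move=> t _; have [] := dh t.
    by apply: cvg_at_right_filter; exact: ch.
  by apply: cvg_at_left_filter; exact: ch.
rewrite /Rintegral (@continuous_FTC2 _ h' h) //.
  exact: continuous_subspaceT.
by move=> t _; rewrite derive1E; have [] := dh t.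
Qed.

Lemma AC_derive (f g : R -> C) :
  (forall t, is_derive t (1 : R) (cRe f) (cRe g t)) ->
  (forall t, is_derive t (1 : R) (cIm f) (cIm g t)) ->
  continuous (cRe g) -> continuous (cIm g) -> AC_with_derivative f g.
Proof.
move=> df1 df2 cg1 cg2; split.
  by split; apply: continuous_compact_integrable;
    [exact: segment_compact|exact: continuous_subspaceT
    |exact: segment_compact|exact: continuous_subspaceT].
move=> x /andP[x0 _]; apply: complex_eq; rewrite ?cReD ?cImD /=.
  by rewrite (@Rintegral_derive (cRe f)) // addrC subrK.
by rewrite (@Rintegral_derive (cIm f)) // addrC subrK.
Qed.

(** The exponential of the complex number z x, for real x. *)
Definition expc z x : C :=
  (expR (complex.Re z * x) * cos (complex.Im z * x)) +i*
  (expR (complex.Re z * x) * sin (complex.Im z * x)).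

Lemma expc0 z : expc z 0 = 1.
Proof. by rewrite /expc !mulr0 expR0 cos0 sin0 mulr1 mulr0. Qed.

Lemma expcD z x y : expc z (x + y) = expc z x * expc z y.
Proof.
by apply: complex_eq; rewrite ?cReM ?cImM /= !mulrDr expRD ?cosD ?sinD; ring.
Qed.

Lemma expcN z x : expc z (- x) = expc (- z) x.
Proof. by apply: complex_eq; case: z => a b /=; rewrite !mulrN !mulNr. Qed.

Lemma AC_expc z : AC_with_derivative (expc z) (fun x => z * expc z x).
Proof.
case: z => a b; set z := a +i* b.
have da t : is_derive t (1 : R) (fun x => expR (a * x)) (a * expR (a * t)).
  have -> : (fun x => expR (a * x)) = expR \o (fun x => a * x) by [].
  by apply: is_derive_eq; rewrite /GRing.scale /=; ring.
have dc t : is_derive t (1 : R) (fun x => cos (b * x)) (- b * sin (b * t)).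
  have -> : (fun x => cos (b * x)) = cos \o (fun x => b * x) by [].
  by apply: is_derive_eq; rewrite /GRing.scale /=; ring.
have ds t : is_derive t (1 : R) (fun x => sin (b * x)) (b * cos (b * t)).
  have -> : (fun x => sin (b * x)) = sin \o (fun x => b * x) by [].
  by apply: is_derive_eq; rewrite /GRing.scale /=; ring.
have cont (h h' : R -> R) : (forall t, is_derive t (1 : R) h (h' t)) -> continuous h.
  move=> dh t; apply: differentiable_continuous; apply/derivable1_diffP.
  by have [] := dh t.
have d1 t : is_derive t (1 : R) (cRe (expc z))
   (cRe (fun x => z * expc z x) t).
  apply: (is_derive_eq (is_deriveM (da t) (dc t))).
  by rewrite /cRe cReM /GRing.scale /=; ring.
have d2 t : is_derive t (1 : R) (cIm (expc z))
   (cIm (fun x => z * expc z x) t).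
  apply: (is_derive_eq (is_deriveM (da t) (ds t))).
  by rewrite /cIm cImM /GRing.scale /=; ring.
have cl (u v : R) (h k : R -> R) : continuous h -> continuous k ->
   continuous (fun x => u * h x + v * k x).
  move=> ch ck x; apply: cvgD; apply: cvgM; try exact: cvg_cst; [exact: ch|exact: ck].
apply: AC_derive => //.
  rewrite (_ : cRe _ = (fun x => a * cRe (expc z) x + - b * cIm (expc z) x)).
    exact: cl (cont _ _ d1) (cont _ _ d2).
  by apply/funext => x; rewrite /cRe /cIm cReM /=; ring.
rewrite (_ : cIm _ = (fun x => a * cIm (expc z) x + b * cRe (expc z) x)).
  exact: cl (cont _ _ d2) (cont _ _ d1).
by apply/funext => x; rewrite /cRe /cIm cImM /=; ring.
Qed.

Lemma ckernel_expc z : ckernel (fun x _ => expc z x).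
Proof.
have cm (u : R) : rkernel (fun x _ => u * x).
  by apply: rkernelM; [exact: rkernel_cst|exact: rkernel_fst].
have h0 (h : R -> R) (u : R) : continuous h -> rkernel (fun x _ => h (u * x)).
  by move=> ch; exact: (rkernel_comp (rkernel_continuous ch) (cm u) (rkernel_cst 0)).
split=> /=; apply: rkernelM; apply: h0.
- exact: continuous_expR.
- exact: continuous_cos.
- exact: continuous_expR.
- exact: continuous_sin.
Qed.

(** The model is c(x) = cos(rho x), s(x) = sin(rho x) / rho with
    rho^2 = lambda, and c = 1, s(x) = x when lambda = 0; only these
    properties are used later, so that lambda = 0 is not a special case. *)
Record sine_cosine lam (c s : R -> C) : Prop := SineCosine {
  sc_c0 : c 0 = 1;
  sc_s0 : s 0 = 0;
  sc_dc : AC_with_derivative c (fun x => - lam * s x);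
  sc_ds : AC_with_derivative s c;
  sc_kc : ckernel (fun x _ => c x);
  sc_ks : ckernel (fun x _ => s x);
  sc_cD : forall x y, c (x + y) = c x * c y - lam * (s x * s y);
  sc_sD : forall x y, s (x + y) = s x * c y + c x * s y;
  sc_cN : forall x, c (- x) = c x;
  sc_sN : forall x, s (- x) = - s x
}.

(** With r^2 = - lambda, the functions are the hyperbolic cosine of r x and
    the hyperbolic sine of r x divided by r. *)
Lemma sine_cosine_exists lam : exists c s, sine_cosine lam c s.
Proof.
have [->|lam0] := eqVneq lam 0.
  have dx t : is_derive t (1 : R) (cRe (fun x : R => x%:C)) (cRe (fun=> 1 : C) t).
    exact: is_derive_id.
  have d0 t : is_derive t (1 : R) (cIm (fun x : R => x%:C)) (cIm (fun=> 1 : C) t).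
    exact: is_derive_cst.
  exists (fun=> 1), (fun x => x%:C); split => //.
  - by apply: AC_eq (AC_cst 1) _ _ => // x _; ring.
  - by apply: AC_derive => //= x; exact: cvg_cst.
  - exact: ckernel_cst.
  - by split; [exact: rkernel_fst|exact: rkernel_cst].
  - by move=> x y; ring.
  - by move=> x y; rewrite rmorphD /=; ring.
  - by move=> x; rewrite rmorphN.
pose r := sqrtC (- lam).
have r2 : r * r = - lam by rewrite -expr2 sqrtCK.
have r0 : r != 0 by rewrite sqrtC_eq0 oppr_eq0.
have lamE : lam = - (r * r) by rewrite r2 opprK.
pose c x := (expc r x + expc (- r) x) / 2.
pose s x := (expc r x - expc (- r) x) / (2 * r).
have Ar := AC_expc r; have Am := AC_expc (- r).
have inv x : expc r x * expc (- r) x = 1 by rewrite -expcN -expcD subrr expc0.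
exists c, s; split.
- by rewrite /c !expc0; field.
- by rewrite /s !expc0 subrr mul0r.
- apply: AC_eq (AC_Z 2^-1 (AC_D Ar Am)) _ _ => x _; rewrite /c /s.
    by rewrite mulrC.
  by rewrite lamE; field.
- apply: AC_eq (AC_Z (2 * r)^-1 (AC_B Ar Am)) _ _ => x _; rewrite /c /s.
    by rewrite mulrC.
  by field.
- apply: ckernelM; last exact: ckernel_cst.
  by apply: ckernelD; exact: ckernel_expc.
- apply: ckernelM; last exact: ckernel_cst.
  by apply: ckernelB; exact: ckernel_expc.
- by move=> x y; rewrite /c /s !expcD lamE; field.
- by move=> x y; rewrite /c /s !expcD; field.
- by move=> x; rewrite /c !expcN opprK addrC.
- by move=> x; rewrite /s !expcN opprK -mulNr opprB.
Qed.

Lemma sine_cosine_sqr lam c s x : sine_cosine lam c s ->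
  c x * c x + lam * (s x * s x) = 1.
Proof.
move=> h; have := sc_cD h x (- x).
by rewrite subrr (sc_c0 h) (sc_cN h) (sc_sN h) => ->; ring.
Qed.

End Trigonometry.

(** * Variation of constants *)

Section VariationOfConstants.
Variable R : realType.
Local Notation C := R[i].
Variables (lam : C) (c s : R -> C).
Hypothesis cs : sine_cosine lam c s.
Implicit Types (F u w : R -> C) (x t : R).

(** The solution of y'' + lambda y = F with zero initial data, in separated
    form: it only involves primitives, to which [AC_M] applies.  The
    convolution form is [duhamelE]. *)
Definition duhamel F x := s x * prim (fun t => c t * F t) x - c x * prim (fun t => s t * F t) x.

(** The derivative of [duhamel F]. *)
Definition duhamel' F x :=
  c x * prim (fun t => c t * F t) x + lam * (s x * prim (fun t => s t * F t) x).

Lemma cdensity_cM F : cdensity F -> cdensity (fun t => c t * F t).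
Proof. exact: cdensityM (sc_kc cs). Qed.

Lemma cdensity_sM F : cdensity F -> cdensity (fun t => s t * F t).
Proof. exact: cdensityM (sc_ks cs). Qed.

Lemma AC_duhamel F : cdensity F -> AC_with_derivative (duhamel F) (duhamel' F).
Proof.
move=> hF.
have Ac := AC_prim (cdensity_cM hF); have As := AC_prim (cdensity_sM hF).
apply: AC_eq (AC_B (AC_M (sc_ds cs) Ac) (AC_M (sc_dc cs) As)) _ _ => // x _; rewrite /duhamel'; ring.
Qed.

Lemma AC_duhamel' F : cdensity F ->
  AC_with_derivative (duhamel' F) (fun x => F x - lam * duhamel F x).
Proof.
move=> hF.
have Ac := AC_prim (cdensity_cM hF); have As := AC_prim (cdensity_sM hF).
apply: AC_eq (AC_D (AC_M (sc_dc cs) Ac) (AC_Z lam (AC_M (sc_ds cs) As))) _ _ => // x _; rewrite /duhamel.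
rewrite -[in RHS](mul1r (F x)) -(sine_cosine_sqr x cs); ring.
Qed.

Lemma eq_duhamel F F' x : (forall t, 0 <= t <= x -> F t = F' t) -> duhamel F x = duhamel F' x.
Proof.
move=> FF'; rewrite /duhamel; congr (_ * _ - _ * _); apply: eq_prim => t tx;
  by rewrite FF'.
Qed.

Lemma eq_duhamel' F F' x : (forall t, 0 <= t <= x -> F t = F' t) -> duhamel' F x = duhamel' F' x.
Proof.
move=> FF'; rewrite /duhamel'; congr (_ * _ + _ * (_ * _)); apply: eq_prim => t tx;
  by rewrite FF'.
Qed.

Lemma prim_linear (k : R -> C) z F F' x : ckernel (fun x _ => k x) ->
  cdensity F -> cdensity F' ->
  prim (fun t => k t * (F t + z * F' t)) x =
  prim (fun t => k t * F t) x + z * prim (fun t => k t * F' t) x.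
Proof.
move=> hk hF hF'; have d : cdensity (fun t => k t * F' t) by exact: cdensityM.
rewrite -primZ // -primD; [|exact: cdensityM|exact: cdensityZ].
by apply: eq_prim => t _; ring.
Qed.

Lemma duhamel_linear z F F' x : cdensity F -> cdensity F' ->
  duhamel (fun t => F t + z * F' t) x = duhamel F x + z * duhamel F' x.
Proof.
move=> hF hF'; rewrite /duhamel.
by rewrite !prim_linear //; [ring|exact: sc_ks cs|exact: sc_kc cs].
Qed.

Lemma duhamel'_linear z F F' x : cdensity F -> cdensity F' ->
  duhamel' (fun t => F t + z * F' t) x = duhamel' F x + z * duhamel' F' x.
Proof.
move=> hF hF'; rewrite /duhamel'.
by rewrite !prim_linear //; [ring|exact: sc_ks cs|exact: sc_kc cs].
Qed.

Lemma duhamelE F x : cdensity F -> duhamel F x = prim (fun t => s (x - t) * F t) x.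
Proof.
move=> hF; have [hc hs] := (cdensity_cM hF, cdensity_sM hF).
rewrite /duhamel -mulNr -!primZ // -primD; [|exact: cdensityZ|exact: cdensityZ].
by apply: eq_prim => t _; rewrite (sc_sD cs) (sc_sN cs) (sc_cN cs); ring.
Qed.

Lemma duhamel'E F x : cdensity F -> duhamel' F x = prim (fun t => c (x - t) * F t) x.
Proof.
move=> hF; have [hc hs] := (cdensity_cM hF, cdensity_sM hF).
rewrite /duhamel' mulrA -!primZ // -primD; [|exact: cdensityZ|exact: cdensityZ].
by apply: eq_prim => t _; rewrite (sc_cD cs) (sc_sN cs) (sc_cN cs); ring.
Qed.

(** The combinations c u' + lambda s u and s u' - c u have derivatives c F and
    s F, so both are known; the identity c^2 + lambda s^2 = 1 inverts the
    linear system they form. *)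
Lemma duhamel_solution u u' w F : AC_with_derivative u u' -> AC_with_derivative u' w ->
  cdensity F -> ae_on `]0, pi[ (fun x => w x = F x - lam * u x) ->
  forall x, 0 <= x <= pi ->
    u x = u 0 * c x + u' 0 * s x + duhamel F x /\
    u' x = u' 0 * c x - lam * (u 0 * s x) + duhamel' F x.
Proof.
move=> Au Au' hF wF x xp; have [hc hs] := (cdensity_cM hF, cdensity_sM hF).
have Q1 : AC_with_derivative (fun x => c x * u' x + lam * (s x * u x))
    (fun x => c x * F x).
  apply: AC_ae (AC_D (AC_M (sc_dc cs) Au') (AC_Z lam (AC_M (sc_ds cs) Au))) _ _.
    exact: cdensity_onpi.
  apply: negligibleS wF => t /= h h'; apply: h => tp; rewrite h' //; ring.
have Q2 : AC_with_derivative (fun x => s x * u' x - c x * u x)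
    (fun x => s x * F x).
  apply: AC_ae (AC_B (AC_M (sc_ds cs) Au') (AC_M (sc_dc cs) Au)) _ _.
    exact: cdensity_onpi.
  apply: negligibleS wF => t /= h h'; apply: h => tp; rewrite h' //; ring.
have on (g : R -> C) : prim (onpi g) x = prim g x.
  apply: eq_prim => t /andP[t0 tx]; rewrite onpi_in // t0 (le_trans tx) //.
  by case/andP: xp.
have [_ E1] := (AC_onpiP _ _).1 Q1; have [_ E2] := (AC_onpiP _ _).1 Q2.
have {}E1 := E1 x xp; have {}E2 := E2 x xp.
rewrite on (sc_c0 cs) (sc_s0 cs) in E1; rewrite on (sc_c0 cs) (sc_s0 cs) in E2.
have P1 : prim (fun t => c t * F t) x = c x * u' x + lam * (s x * u x) - u' 0.
  by rewrite E1; ring.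
have P2 : prim (fun t => s t * F t) x = s x * u' x - c x * u x + u 0.
  by rewrite E2; ring.
have S := sine_cosine_sqr x cs.
rewrite /duhamel /duhamel' P1 P2; split.
  by rewrite -[LHS]mul1r -S; ring.
by rewrite -[LHS]mul1r -S; ring.
Qed.

End VariationOfConstants.

(** * The response to the alpha-dependent part vanishes at pi *)

Section Cancellation.
Variable R : realType.
Local Notation mu := (@lebesgue_measure R).
Local Notation C := R[i].
Implicit Types (x t y : R).

Definition above (H : R -> C) x := cintegral (fun t => ⟦x < t⟧ * H t).
Definition below (e : R -> C) x := cintegral (fun t => ⟦t < x⟧ * e t).

Lemma cdensity_box (u v : R) : cdensity (fun t => ⟦u <= t <= v⟧ : C).
Proof.
have bd t : Num.max `|u| `|v| < `|t| -> (u <= t <= v) = false.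
  rewrite gt_max => /andP[ut vt]; apply/negbTE/negP => /andP[h1 h2].
  have hv := ler_norm v; have := ler_norm (- u); rewrite normrN => hu.
  have [t0|t0] := lerP 0 t.
    by move: vt; rewrite (ger0_norm t0) => vt; lra.
  by move: ut; rewrite (ltr0_norm t0) => ut; lra.
split.
  split; last first.
    by exists (Num.max `|u| `|v|) => t /bd tF; rewrite /cRe tF iverson0.
  rewrite (_ : _ \o _ = EFin \o \1_([set` `[u, v]])).
    exact: integrable_indic_itv.
  apply/funext => t /=; rewrite /cRe Re_iverson indicE; congr (_%:R%:E).
  by rewrite mem_setE in_itv.
rewrite (_ : cIm _ = (fun=> 0)); last by apply/funext => t; rewrite /cIm Im_iverson.
by split; [exact: (integrable0 mu)|exists 0].
Qed.

Lemma ckernel_above (H : R -> C) : cdensity H -> ckernel (fun x _ => above H x).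
Proof.
move=> hH; apply: (@ckernel_cintegral _ (fun x t => ⟦x < t⟧)) => //.
by apply: ckernel_lt; [exact: rkernel_fst|exact: rkernel_snd].
Qed.

Lemma ckernel_below (e : R -> C) : cdensity e -> ckernel (fun x _ => below e x).
Proof.
move=> he; apply: (@ckernel_cintegral _ (fun x t => ⟦t < x⟧)) => //.
by apply: ckernel_lt; [exact: rkernel_snd|exact: rkernel_fst].
Qed.

Lemma prim_pi (g : R -> C) : (forall t, ~~ (0 <= t <= pi) -> g t = 0) ->
  prim g pi = cintegral g.
Proof.
move=> g0; apply: eq_cintegral => t.
have [tp|tp] := boolP (0 <= t <= pi); first by rewrite iverson1 mul1r.
by rewrite iverson0 mul0r g0.
Qed.

Variables (a : R) (e H : R -> C).
Hypotheses (a_lo : pi <= 3 * a) (a_hi : 5 * a < 2 * pi).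
Hypotheses (he : cdensity e) (hH : cdensity H).
Hypothesis e_out : forall x, ~~ (3 * a / 2 < x < pi - a) -> e x = 0.
Hypothesis H_out : forall x, ~~ (5 * a / 2 < x < pi) -> H x = 0.
Hypothesis mean0 : cintegral e = 0.
Hypothesis eigen : {ae mu, forall x, 3 * a / 2 < x < pi - a ->
  cintegral (fun t => above H (x + t - a / 2) * e t) = - e x}.

Let bounds : [/\ 0 < a, pi <= 3 * a & 5 * a < 2 * pi].
Proof. by have := pi_gt0 R; move: a_lo a_hi => h1 h2 h3; split; lra. Qed.

Lemma above_out x : pi <= x -> above H x = 0.
Proof.
move=> px; rewrite /above -(cintegral0 R); apply: eq_cintegral => t.
have [xt|_] := boolP (x < t); last by rewrite iverson0 mul0r.
by rewrite H_out ?mulr0 //; lra.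
Qed.

Lemma below_out x : x <= 3 * a / 2 -> below e x = 0.
Proof.
have [a0 a1 a2] := bounds.
move=> px; rewrite /below -(cintegral0 R); apply: eq_cintegral => t.
have [xt|_] := boolP (t < x); last by rewrite iverson0 mul0r.
by rewrite e_out ?mulr0 //; lra.
Qed.

(* [above H] is constant, not zero, far to the left; only its restriction to
   [0, pi] is a density. *)
Let kap := onpi (above H).

Let hkap : cdensity kap.
Proof.
rewrite /kap (_ : onpi _ = (fun t => above H t * ⟦0 <= t <= pi⟧)).
  apply: cdensityM; [exact: ckernel_above|exact: cdensity_box].
by apply/funext => t; rewrite mulrC.
Qed.

(** The left-hand side pairs a tail integral with a delayed convolution.
    Exchanging the integrals and substituting x -> x + t - a/2 turns it into
    the integral of psi(x - a/2) against the operator M applied to [e]: the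
    support condition t <= x - a becomes 3a/2 <= x, and the upper limits of
    integration are enforced by the vanishing of [above H] beyond pi. *)
Lemma adjoint_eigen (psi : R -> C) : ckernel (fun x _ => psi x) ->
  cintegral (fun x => kap x * cintegral (fun t => ⟦t <= x - a⟧ * psi (x - t) * e t)) =
  - cintegral (fun x => psi (x - a / 2) * e x).
Proof.
have [a0 a1 a2] := bounds.
move=> hpsi.
have k1 : ckernel (fun x t => ⟦t <= x - a⟧ * psi (x - t)).
  apply: ckernelM.
    apply: ckernel_le; first exact: rkernel_snd.
    by apply: rkernelB; [exact: rkernel_fst|exact: rkernel_cst].
  by apply: ckernel_comp1 => //; apply: rkernelB; [exact: rkernel_fst|exact: rkernel_snd].
rewrite (cintegral_swap hkap he k1).
pose g x := psi (x - a / 2) * ⟦3 * a / 2 <= x <= pi - a⟧.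
have kpsi : ckernel (fun x _ => psi (x - a / 2)).
  apply: ckernel_comp1 => //.
  by apply: rkernelB; [exact: rkernel_fst|exact: rkernel_cst].
have hg : cdensity g by apply: cdensityM => //; exact: cdensity_box.
have k2 : ckernel (fun t x => above H (x + t - a / 2)).
  apply: (ckernel_comp1 (ckernel_above hH)); apply: rkernelB; last exact: rkernel_cst.
  by apply: rkernelD; [exact: rkernel_snd|exact: rkernel_fst].
transitivity (cintegral (fun t => e t * cintegral (fun x => above H (x + t - a / 2) * g x))).
  apply: eq_cintegral => t.
  have [et|et] := boolP (3 * a / 2 < t < pi - a); last by rewrite e_out ?mul0r.
  congr (_ * _).
  rewrite -(@cintegral_shift _ (fun x => ⟦t <= x - a⟧ * psi (x - t) * kap x) (t - a / 2)); last first.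
    by apply: cdensityM => //; exact: ckernel_section2 k1.
  apply: eq_cintegral => x; rewrite /g /kap /onpi.
  rewrite (_ : x + (t - a / 2) - t = x - a / 2); last by ring.
  rewrite (_ : x + (t - a / 2) = x + t - a / 2); last by ring.
  have [xl|xl] := boolP (3 * a / 2 <= x); last first.
    rewrite (_ : t <= x + t - a / 2 - a = false) ?iverson0 ?andFb ?mul0r ?mulr0 //.
    by apply/negbTE; lra.
  rewrite (_ : t <= x + t - a / 2 - a = true) ?iverson1 ?mul1r; last lra.
  have [xp|xp] := boolP (x + t - a / 2 < pi); last first.
    by rewrite above_out ?mulr0 ?mul0r //; lra.
  have -> : (0 <= x + t - a / 2 <= pi) = true by lra.
  have -> : (x <= pi - a) = true by lra.
  by rewrite /= iverson1; ring.
rewrite (cintegral_swap he hg k2) -cintegralN; last by apply: cdensityM.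
have k3 : ckernel (fun x t => above H (x + t - a / 2)).
  apply: (ckernel_comp1 (ckernel_above hH)); apply: rkernelB; last exact: rkernel_cst.
  by apply: rkernelD; [exact: rkernel_fst|exact: rkernel_snd].
apply: ae_eq_cintegral.
- under eq_fun do rewrite mulrC; apply: cdensityM => //.
  exact: (@ckernel_cintegral _ (fun x t => above H (x + t - a / 2)) e k3 he).
- by apply: cdensityN; exact: cdensityM.
have N : mu.-negligible (~` [set x | 3 * a / 2 < x < pi - a ->
    cintegral (fun t => above H (x + t - a / 2) * e t) = - e x] `|` [set 3 * a / 2; pi - a]).
  apply: negligibleU; first exact: eigen.
  by apply: negligibleU; exact: negligible_set1.
apply: negligibleS N => x /= h; apply: contrapT => h'; apply: h.
have [xl|xl] := eqVneq x (3 * a / 2); first by case: h'; right; left.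
have [xr|xr] := eqVneq x (pi - a); first by case: h'; right; right.
have [xI|xI] := boolP (3 * a / 2 < x < pi - a); last first.
  rewrite e_out // mulr0 oppr0 /g (_ : (_ <= x <= _) = false) ?iverson0 ?mulr0 ?mul0r //.
  by apply: contraNF xI; rewrite !le_eqVlt eq_sym (negbTE xl) (negbTE xr).
have {}eig : cintegral (fun t => above H (x + t - a / 2) * e t) = - e x.
  by apply: contrapT => h2; apply: h'; left => h3; apply: h2; exact: h3.
rewrite eig /g (_ : (_ <= x <= _) = true) ?iverson1; last by lra.
by ring.
Qed.

Variables (lam : C) (c s : R -> C).
Hypothesis cs : sine_cosine lam c s.

(** The coefficient of alpha in the potential.  No indicator of (2a, pi - a/2)
    is needed in the second term: the first factor vanishes for
    x >= pi - a/2 and the second for x <= 2a. *)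
Definition alpha_part (x : R) : C := e x - above H (x + a / 2) * below e (x - a / 2).

Definition delayed t := e t * c (t - a).

(** The coefficient of alpha in the forcing term of the equation, once the
    delayed solution has been computed. *)
Definition source t := alpha_part t * c (t - a) + H t * duhamel c s delayed (t - a).

Let kerB (f : R -> C) (d : R) : ckernel (fun x _ => f x) -> ckernel (fun x _ => f (x - d)).
Proof.
move=> hf; apply: ckernel_comp1 => //.
by apply: rkernelB; [exact: rkernel_fst|exact: rkernel_cst].
Qed.

Let kerD (f : R -> C) (d : R) : ckernel (fun x _ => f x) -> ckernel (fun x _ => f (x + d)).
Proof.
move=> hf; apply: ckernel_comp1 => //.
by apply: rkernelD; [exact: rkernel_fst|exact: rkernel_cst].
Qed.

Lemma alpha_part_out x : ~~ (3 * a / 2 < x < pi - a / 2) -> alpha_part x = 0.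
Proof.
have [a0 a1 a2] := bounds.
move=> hx; rewrite /alpha_part e_out; last by lra.
have [x1|x1] := lerP (pi - a / 2) x.
  by rewrite above_out ?mul0r ?subr0 //; lra.
by rewrite below_out ?mulr0 ?subr0 //; lra.
Qed.

Let hprod : cdensity (fun x => above H (x + a / 2) * below e (x - a / 2)).
Proof.
have [a0 a1 a2] := bounds.
have hk : ckernel (fun x _ => above H (x + a / 2) * below e (x - a / 2)).
  by apply: ckernelM; [apply: kerD; exact: ckernel_above|apply: kerB; exact: ckernel_below].
have := cdensityM hk (cdensity_box 0 pi).
congr cdensity; apply/funext => x.
have [x0|x0] := boolP (0 <= x <= pi); first by rewrite iverson1 mulr1.
rewrite iverson0 mulr0; have [x1|x1] := lerP (pi - a / 2) x.
  by rewrite above_out ?mul0r //; lra.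
by rewrite below_out ?mulr0 //; lra.
Qed.

Lemma cdensity_alpha_part : cdensity alpha_part.
Proof. exact: cdensityB. Qed.

Lemma cdensity_delayed : cdensity delayed.
Proof.
rewrite /delayed; under eq_fun do rewrite mulrC.
by apply: cdensityM => //; apply: kerB; exact: sc_kc cs.
Qed.

Lemma ckernel_duhamel F : cdensity F -> ckernel (fun x _ => duhamel c s F x).
Proof.
move=> hF; apply: ckernelB; apply: ckernelM.
- exact: sc_ks cs.
- by apply: ckernel_prim; exact: (cdensity_cM cs).
- exact: sc_kc cs.
- by apply: ckernel_prim; exact: (cdensity_sM cs).
Qed.

Lemma cdensity_source : cdensity source.
Proof.
rewrite /source; apply: cdensityD.
  under eq_fun do rewrite mulrC; apply: cdensityM; last exact: cdensity_alpha_part.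
  by apply: kerB; exact: sc_kc cs.
under eq_fun do rewrite mulrC; apply: cdensityM => //.
by apply: kerB; apply: ckernel_duhamel; exact: cdensity_delayed.
Qed.

(* Shifting the forcing shifts the response, because the forcing vanishes on
   (0, a). *)
Let duhamel_delayed x :
  duhamel c s delayed (x - a) = duhamel c s (fun t => delayed (t - a)) x.
Proof.
have [a0 a1 a2] := bounds; have hd := cdensity_delayed.
have ks (d : R) : ckernel (fun x _ => s (d - x)).
  apply: ckernel_comp1; first exact: sc_ks cs.
  by apply: rkernelB; [exact: rkernel_cst|exact: rkernel_fst].
rewrite !(duhamelE cs) //; last exact: cdensity_shift.
rewrite /prim -(@cintegral_shift _ (fun t => ⟦0 <= t <= x - a⟧ * _) (- a)); last first.
  by apply: cdensity_itv; exact: cdensityM.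
apply: eq_cintegral => t; have [ta|ta] := boolP (3 * a / 2 < t - a); last first.
  by rewrite /delayed e_out ?mul0r ?mulr0 //; lra.
congr (⟦_⟧ * (s _ * _)); last by ring.
by apply/idP/idP; lra.
Qed.

Let below_le x : cintegral (fun t => ⟦t <= x⟧ * e t) = below e x.
Proof.
have hk (b : R -> bool) : ckernel (fun t _ => ⟦b t⟧) -> cdensity (fun t => ⟦b t⟧ * e t).
  by move=> hb; exact: cdensityM.
apply: (@eq_cintegral_off _ x).
- by apply: hk; apply: ckernel_le; [exact: rkernel_fst|exact: rkernel_cst].
- by apply: hk; apply: ckernel_lt; [exact: rkernel_fst|exact: rkernel_cst].
by move=> t tx; rewrite lt_neqAle tx.
Qed.

Variables (phi phi' : R -> C).
Hypotheses (kphi : ckernel (fun x _ => phi x)) (kphi' : ckernel (fun x _ => phi' x)).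
Hypothesis dphi : AC_with_derivative phi phi'.
Hypothesis phiD : forall x y, phi (x + y) = phi x * c y + phi' x * s y.

(* The product-to-sum formula behind all the cancellations. *)
Let phiM x y : phi x * c y = (phi (x - y) + phi (x + y)) / 2.
Proof. by rewrite !phiD (sc_cN cs) (sc_sN cs); field. Qed.

(* For the constant function 1 the pairing with M e = - e is minus the mean of
   [e]. *)
Let mean_below : cintegral (fun x => kap x * below e (x - a)) = 0.
Proof.
transitivity (- cintegral (fun x => 1 * e x)); last first.
  by under eq_cintegral do rewrite mul1r; rewrite mean0 oppr0.
rewrite -(adjoint_eigen (ckernel_cst 1)); apply: eq_cintegral => x; rewrite -below_le.
by congr (_ * _); apply: eq_cintegral => t; rewrite mulr1.
Qed.

(* The term produced both by the second piece of [alpha_part] and, with the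
   opposite sign, by the delayed response. *)
Let echo x := phi (2 * x - 2 * a) * below e (x - a).

Let kecho : ckernel (fun x _ => echo x).
Proof.
apply: ckernelM; last by apply: kerB; exact: ckernel_below.
apply: ckernel_comp1 => //; apply: rkernelB; last exact: rkernel_cst.
by apply: rkernelM; [exact: rkernel_cst|exact: rkernel_fst].
Qed.

Let part_e : cintegral (fun x => phi x * (e x * c (x - a))) =
  cintegral (fun x => phi (2 * x - a) * e x) / 2.
Proof.
have d1 : cdensity (fun x => phi (2 * x - a) * e x).
  apply: cdensityM => //; apply: ckernel_comp1 => //.
  apply: rkernelB; last exact: rkernel_cst.
  by apply: rkernelM; [exact: rkernel_cst|exact: rkernel_fst].
transitivity (cintegral (fun x => phi a / 2 * e x + 2^-1 * (phi (2 * x - a) * e x))).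
  apply: eq_cintegral => x; rewrite mulrCA phiM.
  rewrite (_ : x - (x - a) = a); last by ring.
  by rewrite (_ : x + (x - a) = 2 * x - a); [field|ring].
by rewrite cintegralD ?cintegralZ //; [rewrite mean0; ring|exact: cdensityZ|exact: cdensityZ].
Qed.

Let part_product :
  cintegral (fun x => phi x * (above H (x + a / 2) * below e (x - a / 2) * c (x - a))) =
  cintegral (fun x => kap x * echo x) / 2.
Proof.
have [a0 a1 a2] := bounds.
have d1 : cdensity (fun x =>
    phi x * (above H (x + a / 2) * below e (x - a / 2) * c (x - a))).
  apply: cdensityM => //; under eq_fun do rewrite mulrC.
  by apply: cdensityM => //; apply: kerB; exact: sc_kc cs.
have dk (k : R -> C) : ckernel (fun x _ => k x) -> cdensity (fun x => kap x * k x).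
  by move=> hk; under eq_fun do rewrite mulrC; exact: cdensityM.
have d2 := dk _ (kerB a (ckernel_below he)); have d3 := dk _ kecho.
rewrite -(@cintegral_shift _ _ (- (a / 2)) d1).
transitivity (cintegral (fun x => phi a / 2 * (kap x * below e (x - a)) +
    2^-1 * (kap x * echo x))); last first.
  by rewrite cintegralD ?cintegralZ //; [rewrite mean_below; ring|exact: cdensityZ|exact: cdensityZ].
apply: eq_cintegral => x; rewrite /echo /kap /onpi.
rewrite (_ : x - a / 2 + a / 2 = x); last by ring.
rewrite (_ : x - a / 2 - a / 2 = x - a); last by field.
have [xl|xl] := lerP x (5 * a / 2).
  by rewrite (below_out (x := x - a)) ?mulr0 ?mul0r ?mulr0 ?addr0 //; lra.
have [xp|xp] := lerP pi x.
  by rewrite above_out ?mulr0 ?mul0r ?mulr0 ?addr0 //; lra.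
rewrite (_ : 0 <= x <= pi = true) ?iverson1; last by lra.
rewrite mulrCA phiM (_ : x - a / 2 - (x - a / 2 - a) = a); last by ring.
by rewrite (_ : x - a / 2 + (x - a / 2 - a) = 2 * x - 2 * a); field.
Qed.

(* Integration by parts moves the derivative from [above H] to the delayed
   response; there is no boundary term, as the response vanishes at 0 and
   [above H] vanishes at pi. *)
Let part_delay : prim (fun x => phi x * (H x * duhamel c s delayed (x - a))) pi =
  (cintegral (fun x => kap x * echo x) - cintegral (fun x => phi (2 * x - a) * e x)) / 2.
Proof.
have [a0 a1 a2] := bounds; have hd := cdensity_delayed.
pose da t := delayed (t - a); have hda : cdensity da by exact: cdensity_shift.
pose z := duhamel c s da; pose z' := duhamel' lam c s da.
have kz : ckernel (fun x _ => z x) by exact: ckernel_duhamel.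
have kz' : ckernel (fun x _ => z' x).
  apply: ckernelD; last (apply: ckernelM; first exact: ckernel_cst); apply: ckernelM.
  - exact: sc_kc cs.
  - by apply: ckernel_prim; exact: (cdensity_cM cs).
  - exact: sc_ks cs.
  - by apply: ckernel_prim; exact: (cdensity_sM cs).
(* The derivative of phi(x) z(x); by the addition formula it is the integral of
   phi(2 x - t) against the forcing over t <= x. *)
pose Z' x := phi' x * z x + phi x * z' x.
have kZ' : ckernel (fun x _ => Z' x) by apply: ckernelD; exact: ckernelM.
have At : AC_with_derivative (above H) (fun x => - H x).
  apply: AC_eq (AC_B (AC_cst (above H 0)) (AC_prim hH)) _ _ => x; last by move=> _; ring.
  move=> /andP[x0 _]; rewrite /above /prim -cintegralB.
  - apply: eq_cintegral => t; have [tH|tH] := boolP (5 * a / 2 < t); last first.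
      by rewrite H_out ?mulr0 ?subr0 //; lra.
    rewrite (_ : (0 < t) = true) ?iverson1; last by lra.
    rewrite (_ : (0 <= t <= x) = ~~ (x < t)); last by rewrite -leNgt; apply/idP/idP; lra.
    by case: (x < t); rewrite ?iverson1 ?iverson0; ring.
  - by apply: cdensityM => //; apply: ckernel_lt; [exact: rkernel_cst|exact: rkernel_fst].
  - exact: cdensity_itv.
have Az := AC_M dphi (AC_duhamel cs hda).
have [_ /(_ pi)] := (AC_onpiP _ _).1 (AC_M At Az).
rewrite lexx andbT pi_ge0 => /(_ isT).
have z0 : duhamel c s da 0 = 0.
  rewrite /duhamel prim0; last exact: (cdensity_cM cs).
  by rewrite prim0; [rewrite !mulr0 subrr|exact: (cdensity_sM cs)].
rewrite above_out // z0 !mulr0 mul0r add0r => parts.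
have dkZ : cdensity (fun x => kap x * Z' x).
  by under eq_fun do rewrite mulrC; exact: cdensityM.
have dHz : cdensity (fun x => phi x * (H x * z x)).
  by apply: cdensityM => //; under eq_fun do rewrite mulrC; exact: cdensityM.
have -> : prim (fun x => phi x * (H x * duhamel c s delayed (x - a))) pi =
    cintegral (fun x => kap x * Z' x).
  rewrite (@eq_prim _ _ (fun x => phi x * (H x * z x))); last first.
    by move=> t _; rewrite duhamel_delayed.
  rewrite -[RHS]prim_pi; last first.
    by move=> t tp; rewrite /kap /onpi (negbTE tp) iverson0 !mul0r.
  apply/eqP; rewrite eq_sym -subr_eq0 -mulN1r -primZ // -primD //; last exact: cdensityZ.
  rewrite [X in X == 0](_ : _ = 0) //; rewrite [RHS]parts; apply: eq_prim => t tp.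
  by rewrite /kap !onpi_in // /Z' /z' /z; ring.
have d2 : cdensity (fun x => kap x * echo x).
  by under eq_fun do rewrite mulrC; exact: cdensityM.
pose psi x := phi (2 * x).
have kpsi : ckernel (fun x _ => psi x).
  exact: (ckernel_comp1 kphi (rkernelM (rkernel_cst 2) (@rkernel_fst R))).
pose G x := cintegral (fun t => ⟦t <= x - a⟧ * psi (x - t) * e t).
have k1 : ckernel (fun x t => ⟦t <= x - a⟧ * psi (x - t)).
  apply: ckernelM.
    apply: ckernel_le; first exact: rkernel_snd.
    by apply: rkernelB; [exact: rkernel_fst|exact: rkernel_cst].
  by apply: ckernel_comp1 => //; apply: rkernelB; [exact: rkernel_fst|exact: rkernel_snd].
have kG : ckernel (fun x _ => G x) by exact: ckernel_cintegral.
have d3 : cdensity (fun x => kap x * G x).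
  by under eq_fun do rewrite mulrC; exact: cdensityM.
have -> : cintegral (fun x => phi (2 * x - a) * e x) = - cintegral (fun x => kap x * G x).
  rewrite /G adjoint_eigen // opprK; apply: eq_cintegral => x; congr (phi _ * _).
  by field.
rewrite opprK -cintegralD // mulrC -cintegralZ; last exact: cdensityD.
apply: eq_cintegral => x; rewrite /kap /onpi; have [xp|xp] := boolP (0 <= x <= pi); last first.
  by rewrite iverson0 !mul0r addr0 mulr0.
rewrite iverson1 !mul1r -mulrDr mulrCA; congr (_ * _).
have ke (f : R -> C) (g : R -> C) : ckernel (fun x _ => f x) -> cdensity g ->
    cdensity (fun t => f (x - t) * g t).
  move=> kf hg; apply: cdensityM => //; apply: ckernel_comp1 => //.
  by apply: rkernelB; [exact: rkernel_cst|exact: rkernel_fst].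
have dc := ke _ _ (sc_kc cs) hda; have ds := ke _ _ (sc_ks cs) hda.
rewrite /Z' /z /z' (duhamelE cs) // (duhamel'E cs) // -!primZ // -primD; try exact: cdensityZ.
have dtot : cdensity (fun t => phi (2 * x - t) * da t).
  apply: cdensityM => //; apply: ckernel_comp1 => //.
  by apply: rkernelB; [exact: rkernel_cst|exact: rkernel_fst].
transitivity (prim (fun t => phi (2 * x - t) * da t) x).
  apply: eq_prim => t _; rewrite (_ : 2 * x - t = x + (x - t)); last by ring.
  by rewrite phiD; ring.
rewrite /prim -(@cintegral_shift _ (fun t => ⟦0 <= t <= x⟧ * _) a); last exact: cdensity_itv.
have dG : cdensity (fun t => ⟦t <= x - a⟧ * psi (x - t) * e t).
  by apply: cdensityM => //; exact: ckernel_section k1.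
have dh : cdensity (fun t => ⟦t <= x - a⟧ * e t).
  by apply: cdensityM => //; apply: ckernel_le; [exact: rkernel_fst|exact: rkernel_cst].
rewrite /G /echo -below_le -cintegralZ // -cintegralD //; last exact: cdensityZ.
rewrite -cintegralZ; last by apply: cdensityD => //; exact: cdensityZ.
apply: eq_cintegral => t; have [te|te] := boolP (3 * a / 2 < t); last first.
  by rewrite /da /delayed addrK e_out ?(mulr0, mul0r) ?addr0 ?mulr0 //; lra.
rewrite /da /delayed addrK (_ : (0 <= t + a <= x) = (t <= x - a)); last first.
  by apply/idP/idP; lra.
rewrite [phi _ * _]mulrCA phiM (_ : 2 * x - (t + a) - (t - a) = 2 * (x - t)); last by ring.
rewrite (_ : 2 * x - (t + a) + (t - a) = 2 * x - 2 * a); last by ring.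
by rewrite /psi; field.
Qed.

Lemma source_orthogonal : prim (fun x => phi x * source x) pi = 0.
Proof.
have [a0 a1 a2] := bounds; have hd := cdensity_delayed.
have d1 : cdensity (fun x => phi x * (e x * c (x - a))).
  by apply: cdensityM => //; exact: cdensity_delayed.
have d2 : cdensity (fun x =>
    phi x * (above H (x + a / 2) * below e (x - a / 2) * c (x - a))).
  apply: cdensityM => //; under eq_fun do rewrite mulrC.
  by apply: cdensityM => //; apply: kerB; exact: sc_kc cs.
have d3 : cdensity (fun x => phi x * (H x * duhamel c s delayed (x - a))).
  apply: cdensityM => //; under eq_fun do rewrite mulrC.
  by apply: cdensityM => //; apply: kerB; exact: ckernel_duhamel.
rewrite (@eq_prim _ _ (fun x => (phi x * (e x * c (x - a)) +
   -1 * (phi x * (above H (x + a / 2) * below e (x - a / 2) * c (x - a)))) +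
   phi x * (H x * duhamel c s delayed (x - a)))); last first.
  by move=> t _; rewrite /source /alpha_part; ring.
rewrite !primD ?primZ //; [|exact: cdensityZ|by apply: cdensityD => //; exact: cdensityZ].
rewrite part_delay !prim_pi ?part_e ?part_product; first by ring.
  move=> t tp; have [h|h] := lerP (pi - a / 2) t.
    by rewrite above_out ?mul0r ?mulr0 //; lra.
  by rewrite below_out ?mulr0 ?mul0r ?mulr0 //; lra.
by move=> t tp; rewrite e_out ?mul0r ?mulr0 //; lra.
Qed.

End Cancellation.

(** * The characteristic functions *)

Section CharacteristicFunction.
Variable R : realType.
Local Notation mu := (@lebesgue_measure R).
Local Notation C := R[i].
Implicit Types (x t y : R).

Lemma duhamel_eq0 (c s F : R -> C) x : (forall t, 0 <= t <= x -> F t = 0) -> duhamel c s F x = 0.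
Proof.
move=> F0; have P (k : R -> C) : prim (fun t => k t * F t) x = 0.
  rewrite /prim -(cintegral0 R); apply: eq_cintegral => t.
  have [tx|_] := boolP (0 <= t <= x); last by rewrite iverson0 mul0r.
  by rewrite F0 // !mulr0.
by rewrite /duhamel !P !mulr0 subrr.
Qed.

Lemma duhamel'_at0 lam (c s F : R -> C) : cdensity (fun t => c t * F t) ->
  cdensity (fun t => s t * F t) -> duhamel' lam c s F 0 = 0.
Proof. by move=> h1 h2; rewrite /duhamel' !prim0 // !mulr0 addr0. Qed.

Variables (a : R) (e H q : R -> C) (alpha : C).
Hypotheses (a_lo : pi <= 3 * a) (a_hi : 5 * a < 2 * pi).
Hypotheses (he : cdensity e) (hH : cdensity H).
Hypothesis e_out : forall x, ~~ (3 * a / 2 < x < pi - a) -> e x = 0.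
Hypothesis H_out : forall x, ~~ (5 * a / 2 < x < pi) -> H x = 0.
Hypothesis mean0 : cintegral e = 0.
Hypothesis eigen : {ae mu, forall x, 3 * a / 2 < x < pi - a ->
  cintegral (fun t => above H (x + t - a / 2) * e t) = - e x}.
Hypothesis qE : forall x, q x = alpha * alpha_part a e H x + H x.

Variables (lam : C) (c s : R -> C).
Hypothesis cs : sine_cosine lam c s.

Let bounds : [/\ 0 < a, pi <= 3 * a & 5 * a < 2 * pi].
Proof. by have := pi_gt0 R; move: a_lo a_hi => h1 h2 h3; split; lra. Qed.

Let halpha_part : cdensity (alpha_part a e H).
Proof. exact: cdensity_alpha_part. Qed.

Let hq : cdensity q.
Proof.
have -> : q = (fun x => alpha * alpha_part a e H x + H x) by apply/funext => x; exact: qE.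
by apply: cdensityD => //; exact: cdensityZ.
Qed.

Let q_out x : ~~ (3 * a / 2 < x < pi) -> q x = 0.
Proof.
have [a0 a1 a2] := bounds => hx.
by rewrite qE (alpha_part_out a_lo a_hi) ?H_out ?mulr0 ?addr0 //; lra.
Qed.

Let q_left x : x <= pi - a -> q x = alpha * e x.
Proof.
have [a0 a1 a2] := bounds => hx.
rewrite qE H_out; last by lra.
by rewrite /alpha_part (below_out a_lo a_hi) ?mulr0 ?subr0 ?addr0 //; lra.
Qed.

Let d := delayed a e c.

Let hd : cdensity d.
Proof. exact: (cdensity_delayed _ he cs). Qed.

Let z1 := duhamel c s d.

Let z1_out y : y <= 3 * a / 2 -> z1 y = 0.
Proof.
move=> hy; apply: duhamel_eq0 => t ht.
by rewrite /d /delayed e_out ?mul0r //; lra.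
Qed.

Let duhamelZ F z x : cdensity F -> duhamel c s (fun t => z * F t) x = z * duhamel c s F x.
Proof.
move=> hF.
have h0 : cdensity (fun _ : R => 0 : C).
  by have := cdensityZ 0 hF; under eq_fun do rewrite mul0r.
have := duhamel_linear cs z x h0 hF; rewrite [X in _ = X + _]duhamel_eq0 // add0r => <-.
by apply: eq_duhamel => t _; rewrite add0r.
Qed.

Let base t := H t * c (t - a).

(* The forcing term of the solution for the potential q. *)
Let F t := base t + alpha * source a e H c s t.

Let kcB : ckernel (fun x _ => c (x - a)).
Proof.
apply: ckernel_comp1; first exact: sc_kc cs.
by apply: rkernelB; [exact: rkernel_fst|exact: rkernel_cst].
Qed.

Let hbase : cdensity base.
Proof. by rewrite /base; under eq_fun do rewrite mulrC; exact: cdensityM. Qed.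

Let hsource : cdensity (source a e H c s).
Proof. exact: (cdensity_source a_lo a_hi he hH e_out H_out cs). Qed.

Let hF : cdensity F.
Proof. by apply: cdensityD => //; exact: cdensityZ. Qed.

(* The term quadratic in alpha vanishes, as the support of [alpha_part] ends
   before the delayed response starts. *)
Let FE t : F t = q t * (c (t - a) + alpha * z1 (t - a)).
Proof.
have [a0 a1 a2] := bounds.
rewrite /F /base /source -/d -/z1 qE.
have [tb|tb] := boolP (3 * a / 2 < t < pi - a / 2); last first.
  by rewrite (alpha_part_out a_lo a_hi) // ; ring.
by rewrite z1_out; [ring|lra].
Qed.

Let F_left t : t <= pi - a -> F t = alpha * d t.
Proof.
have [a0 a1 a2] := bounds => ht.
by rewrite FE q_left // z1_out; [rewrite /d /delayed; ring|lra].
Qed.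

Let duhamel_F y : y <= pi - a -> duhamel c s F y = alpha * z1 y.
Proof.
move=> hy; rewrite -duhamelZ //. apply: eq_duhamel => t /andP[_ ty].
by rewrite F_left // (le_trans ty hy).
Qed.

Lemma AC_reversed : AC_with_derivative (fun t => s (pi - t)) (fun t => - c (pi - t)) /\
  AC_with_derivative (fun t => c (pi - t)) (fun t => lam * s (pi - t)).
Proof.
have sB x y : s (x - y) = s x * c y - c x * s y.
  by rewrite (sc_sD cs) (sc_sN cs) (sc_cN cs); ring.
have cB x y : c (x - y) = c x * c y + lam * (s x * s y).
  by rewrite (sc_cD cs) (sc_sN cs) (sc_cN cs); ring.
split.
  apply: AC_eq (AC_B (AC_Z (s pi) (sc_dc cs)) (AC_Z (c pi) (sc_ds cs))) _ _ => t _.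
    by rewrite sB.
  by rewrite cB; ring.
apply: AC_eq (AC_D (AC_Z (c pi) (sc_dc cs)) (AC_Z (lam * s pi) (sc_ds cs))) _ _ => t _.
  by rewrite cB; ring.
by rewrite sB; ring.
Qed.

Let duhamel_source : duhamel c s (source a e H c s) pi = 0 /\
  duhamel' lam c s (source a e H c s) pi = 0.
Proof.
have kr (f : R -> C) : ckernel (fun x _ => f x) -> ckernel (fun x _ => f (pi - x)).
  move=> hf; apply: ckernel_comp1 => //.
  by apply: rkernelB; [exact: rkernel_cst|exact: rkernel_fst].
have [ks kc] := (kr _ (sc_ks cs), kr _ (sc_kc cs)); have [A1 A2] := AC_reversed.
rewrite (duhamelE cs) // (duhamel'E cs) //; split.
  apply: (source_orthogonal a_lo a_hi he hH e_out H_out mean0 eigen cs ks _ A1).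
    exact: ckernelN.
  move=> x y; rewrite (_ : pi - (x + y) = (pi - x) + - y); last by ring.
  by rewrite (sc_sD cs) (sc_sN cs) (sc_cN cs); ring.
apply: (source_orthogonal a_lo a_hi he hH e_out H_out mean0 eigen cs kc _ A2).
  by apply: ckernelM => //; exact: ckernel_cst.
move=> x y; rewrite (_ : pi - (x + y) = (pi - x) + - y); last by ring.
by rewrite (sc_cD cs) (sc_sN cs) (sc_cN cs); ring.
Qed.

(** The value at pi of the solution for alpha = 0. *)
Definition endpoint (j : bool) : C :=
  if j then - lam * s pi + duhamel' lam c s (fun t => H t * c (t - a)) pi
  else c pi + duhamel c s (fun t => H t * c (t - a)) pi.

(** The method of steps: the solution is determined on [[0, 3a/2]], then on
    [[0, pi - a]], then on [[0, pi]], each interval supplying the delayed values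
    needed on the next. *)
Lemma solution_endpoint (u : bool -> R -> C) j : solution a q lam u ->
  u false 0 = 1 -> u true 0 = 0 -> u j pi = endpoint j.
Proof.
have [a0 a1 a2] := bounds; have p0 := pi_gt0 R.
move=> [Au [w Aw uE]] u00 u10.
pose Fu t := q t * onpi (u false) (t - a).
have hFu : cdensity Fu.
  rewrite /Fu; under eq_fun do rewrite mulrC; apply: cdensityM => //.
  apply: (ckernel_comp1 (AC_ckernel Au)).
  by apply: rkernelB; [exact: rkernel_fst|exact: rkernel_cst].
have wE : ae_on `]0, pi[ (fun x => w x = Fu x - lam * u false x).
  apply: negligibleS uE => x /= h h'; apply: h => xp; rewrite -h' // /Fu.
  have [qx|qx] := boolP (3 * a / 2 < x < pi); last by rewrite q_out //; ring.
  by rewrite onpi_in; [ring|lra].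
have sol := duhamel_solution cs Au Aw hFu wE.
have u1 y : 0 <= y <= 3 * a / 2 -> u false y = c y.
  move=> hy; have [|-> _] := sol y; first by lra.
  rewrite u00 u10 duhamel_eq0; first by ring.
  by move=> t ht; rewrite /Fu q_out ?mul0r //; lra.
have u2 y : 0 <= y <= pi - a -> u false y = c y + alpha * z1 y.
  move=> hy; have [|-> _] := sol y; first by lra.
  rewrite u00 u10 -duhamelZ // (@eq_duhamel _ c s Fu (fun t => alpha * d t)); first by ring.
  move=> t ht; rewrite /Fu q_left; last by lra.
  have [te|te] := boolP (3 * a / 2 < t < pi - a); last first.
    by rewrite /d /delayed e_out //; ring.
  by rewrite onpi_in ?u1 /d /delayed; [ring|lra|lra].
have FuF t : Fu t = F t.
  rewrite /Fu FE; have [tq|tq] := boolP (3 * a / 2 < t < pi); last by rewrite q_out // !mul0r.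
  by congr (_ * _); rewrite onpi_in ?u2 //; lra.
have [|e1 e2] := sol pi; first by rewrite lexx pi_ge0.
have [s1 s2] := duhamel_source.
rewrite /endpoint; case: j.
  rewrite e2 u00 u10 (@eq_duhamel' _ _ c s Fu F); last by move=> t _.
  by rewrite (duhamel'_linear cs alpha pi hbase hsource) s2 /base; ring.
rewrite e1 u00 u10 (@eq_duhamel _ c s Fu F); last by move=> t _.
by rewrite (duhamel_linear cs alpha pi hbase hsource) s1 /base; ring.
Qed.

(** The function found by the method of steps is a solution, so the chosen
    fundamental solution is not a default value. *)
Lemma solution_exists : exists u : bool -> R -> C,
  solution a q lam u /\ forall j, u j 0 = (false == j)%:R.
Proof.
have [a0 a1 a2] := bounds.
exists (fun j x => if j then - lam * s x + duhamel' lam c s F x else c x + duhamel c s F x).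
split; last first.
  case.
    by rewrite (sc_s0 cs) duhamel'_at0 ?mulr0 ?addr0 //;
      [exact: (cdensity_cM cs)|exact: (cdensity_sM cs)].
  by rewrite (sc_c0 cs) duhamel_F ?z1_out ?mulr0 ?addr0 //; lra.
split; first exact: AC_D (sc_dc cs) (AC_duhamel cs hF).
exists (fun x => - lam * c x + (F x - lam * duhamel c s F x)).
  exact: AC_D (AC_Z (- lam) (sc_ds cs)) (AC_duhamel' cs hF).
suff h x : 0 < x < pi -> - (- lam * c x + (F x - lam * duhamel c s F x)) +
    q x * (c (x - a) + duhamel c s F (x - a)) = lam * (c x + duhamel c s F x).
  apply: negligibleS (negligible_set0 mu) => x /= h'; apply: h' => xp; apply: h.
  by move: xp; rewrite in_itv.
move=> /andP[x0 xp]; rewrite (@duhamel_F (x - a)); last by lra.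
by rewrite FE; ring.
Qed.

Lemma Delta_endpoint j : Delta true j a q lam = endpoint j.
Proof.
rewrite /Delta /fundamental_solution.
case: xgetP => [u _ /= [su u0]|/= h]. 
  by apply: solution_endpoint su _ _; rewrite u0.
by have [u hu] := solution_exists; case: (h u).
Qed.

End CharacteristicFunction.

(** * The data of the problem as functions on the line *)

Section Hypotheses.
Variable R : realType.
Local Notation mu := (@lebesgue_measure R).
Local Notation C := R[i].

(** On a bounded interval square integrability gives integrability, by
    |g| <= 1 + g^2. *)
Lemma L2_cdensity (u v : R) (f : R -> C) : L2 `]u, v[ f ->
  cdensity (fun x => ⟦u < x < v⟧ * f x).
Proof.
have key (g : R -> R) : g \_ `]u, v[ \in Lfun mu 2%:E -> rdensity (g \_ `]u, v[).
  move=> hg; have i2 := Lfun2_integrable_sqr hg.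
  have mg : measurable_fun setT (g \_ `]u, v[).
    by move: hg; rewrite inE => /andP[+ _]; rewrite inE.
  split.
    have i3 := integrableD measurableT (@integrable_indic_itv R u v false true) i2.
    apply: le_integrable i3 => //; first exact/measurable_EFinP.
    move=> x _ /=; rewrite lee_fin indicE mem_setE patchE mem_setE.
    rewrite [leRHS]ger0_norm; last by rewrite addr_ge0 // sqr_ge0.
    case: ifPn => _; last by rewrite normr0 addr_ge0 // sqr_ge0.
    rewrite -real_normK ?num_real //.
    have h1 := sqr_ge0 (`|g x| - 1); have := normr_ge0 (g x).
    by rewrite /=; move: h1; set y := `|g x| => h1 h2; rewrite mulr1n; nra.
  exists (Num.max `|u| `|v|) => x; rewrite gt_max => /andP[xu xv].
  rewrite patchE; case: ifPn => //; rewrite mem_setE in_itv /= => xD.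
  have hv := ler_norm v; have := ler_norm (- u); rewrite normrN => hu.
  have [x0|x0] := lerP 0 x.
    by move: xv; rewrite (ger0_norm x0) => xv; lra.
  by move: xu; rewrite (ltr0_norm x0) => xu; lra.
move=> [/key h1 /key h2]; split.
  congr rdensity : h1; apply/funext => x; rewrite patchE mem_setE in_itv /= /cRe cReM.
  by rewrite Re_iverson Im_iverson; case: (_ < _ < _); rewrite ?mul1r ?mul0r ?subr0.
congr rdensity : h2; apply/funext => x; rewrite patchE mem_setE in_itv /= /cIm cImM.
by rewrite Re_iverson Im_iverson; case: (_ < _ < _); rewrite ?mul1r ?mul0r ?addr0.
Qed.

Lemma Cintegral_ooE (u v : R) (f : R -> C) :
  Cintegral `]u, v[ f = cintegral (fun x => ⟦u < x < v⟧ * f x).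
Proof. by rewrite Cintegral_indic; apply: eq_cintegral => x; rewrite mem_setE in_itv. Qed.

Lemma K_above (b : R) (h1 : R -> C) y : b <= y ->
  K h1 y = above (fun x => ⟦b < x < pi⟧ * h1 x) y.
Proof.
move=> ay; rewrite /K Cintegral_ooE /above; apply: eq_cintegral => t.
rewrite mulrA -iversonM; congr (⟦_⟧ * _); apply/idP/idP; lra.
Qed.

Lemma eigen_M (a : R) (h1 e1 : R -> C) (x : R) : 3 * a / 2 < x < pi - a ->
  M a h1 e1 x = cintegral (fun t => above (fun x => ⟦5 * a / 2 < x < pi⟧ * h1 x) (x + t - a / 2) *
    (⟦3 * a / 2 < t < pi - a⟧ * e1 t)).
Proof.
move=> hx; rewrite /M Cintegral_ooE; apply: eq_cintegral => t.
have [t1|t1] := boolP (3 * a / 2 < t); last first.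
  by rewrite andFb iverson0 !mul0r mulr0.
rewrite andTb; have [t2|t2] := boolP (t < pi - x + a / 2); last first.
  rewrite iverson0 mul0r (@above_out _ a) ?mul0r //; last by lra.
  by move=> y hy; rewrite (negbTE hy) iverson0 mul0r.
rewrite iverson1 mul1r (@K_above (5 * a / 2)); last by lra.
by rewrite (_ : t < pi - a = true) ?iverson1 ?mul1r //; lra.
Qed.

Lemma potentialE (a : R) (h1 e1 : R -> C) (alpha : C) (x : R) :
  pi <= 3 * a -> 5 * a < 2 * pi ->
  potential a h1 e1 alpha x =
  alpha * alpha_part a (fun x => ⟦3 * a / 2 < x < pi - a⟧ * e1 x)
    (fun x => ⟦5 * a / 2 < x < pi⟧ * h1 x) x + ⟦5 * a / 2 < x < pi⟧ * h1 x.
Proof.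
move=> a1 a2; have p0 := pi_gt0 R; have a0 : 0 < a by lra.
set e := fun x => _ * e1 x; set H := fun x => _ * h1 x.
have e_out y : ~~ (3 * a / 2 < y < pi - a) -> e y = 0.
  by move=> hy; rewrite /e (negbTE hy) iverson0 mul0r.
have H_out y : ~~ (5 * a / 2 < y < pi) -> H y = 0.
  by move=> hy; rewrite /H (negbTE hy) iverson0 mul0r.
rewrite /potential -/(H x) /alpha_part.
case: ifPn => [x1|x1].
  rewrite (below_out a1 a2 e_out); last by lra.
  by rewrite H_out /e ?x1 ?iverson1; [ring|lra].
rewrite e_out //; case: ifPn => [x2|x2].
  rewrite H_out; last by lra.
  rewrite (@K_above (5 * a / 2)) -/H; last by lra.
  rewrite Cintegral_ooE (_ : cintegral _ = below e (x - a / 2)); first by ring.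
  apply: eq_cintegral => t; rewrite /e mulrA -iversonM.
  by congr (⟦_⟧ * _); apply/idP/idP; lra.
have -> : above H (x + a / 2) * below e (x - a / 2) = 0.
  have [x3|x3] := lerP x (2 * a).
    by rewrite (below_out a1 a2 e_out) ?mulr0 //; lra.
  by rewrite (above_out H_out) ?mul0r //; lra.
case: ifPn => [x3|x3]; last by rewrite H_out //; ring.
by rewrite /H x3 iverson1; ring.
Qed.

End Hypotheses.

Theorem theorem1 (R : realType) (a : R) (a_range : pi / 3 <= a < 2 * pi / 5)
  (h : R -> R)
  (h_L2 : L2 `]5 * a / 2, pi[ (fun x => (h x)%:C))
  (h_neq0 : ~ ae_on `]5 * a / 2, pi[ (fun x => h x = 0))
  (eta : R[i]) (eta_neq0 : eta != 0)
  (eta_eigen :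
    L2_eigenvalue `]3 * a / 2, pi - a[ (M a (fun x => (h x)%:C)) eta)
  (h1 : R -> R[i]) (h1_def : forall x, h1 x = - (h x)%:C / eta)
  (e1 : R -> R[i])
  (e1_eigen : L2_eigenfunction `]3 * a / 2, pi - a[ (M a h1) (-1) e1)
  (e1_mean0 : Cintegral `]3 * a / 2, pi - a[ e1 = 0)
  (j : bool) (alpha beta : R[i]) :
  spectrum true j a (potential a h1 e1 alpha) =
  spectrum true j a (potential a h1 e1 beta).
Proof.
have a1 : pi <= 3 * a by case/andP: a_range => l1 l2; lra.
have a2 : 5 * a < 2 * pi by case/andP: a_range => l1 l2; lra.
pose e x := ⟦3 * a / 2 < x < pi - a⟧ * e1 x.
pose H x := ⟦5 * a / 2 < x < pi⟧ * h1 x.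
have [e1_L2 _ e1_ae] := e1_eigen.
have he : cdensity e by exact: L2_cdensity.
have hH : cdensity H.
  have := cdensityZ (- eta^-1) (L2_cdensity h_L2); congr cdensity.
  by apply/funext => x; rewrite /H h1_def; ring.
have e_out x : ~~ (3 * a / 2 < x < pi - a) -> e x = 0.
  by move=> hx; rewrite /e (negbTE hx) iverson0 mul0r.
have H_out x : ~~ (5 * a / 2 < x < pi) -> H x = 0.
  by move=> hx; rewrite /H (negbTE hx) iverson0 mul0r.
have mean0 : cintegral e = 0 by rewrite -Cintegral_ooE.
have eigen : {ae lebesgue_measure, forall x, 3 * a / 2 < x < pi - a ->
    cintegral (fun t => above H (x + t - a / 2) * e t) = - e x}.
  apply: negligibleS e1_ae => x /= h' h''; apply: h' => hx.
  have := h'' _; rewrite /= in_itv /= => /(_ hx).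
  by rewrite eigen_M // /e hx iverson1 mul1r mulN1r.
have D_eq al lam c s : sine_cosine lam c s ->
    Delta true j a (potential a h1 e1 al) lam = endpoint a H lam c s j.
  move=> cs.
  exact: (Delta_endpoint a1 a2 he hH e_out H_out mean0 eigen
    (fun x => potentialE h1 e1 al x a1 a2) cs).
rewrite /spectrum; have -> // : Delta true j a (potential a h1 e1 alpha) =
  Delta true j a (potential a h1 e1 beta).
apply/funext => lam; have [c [s cs]] := sine_cosine_exists lam.
by rewrite !(D_eq _ _ _ _ cs).
Qed.
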